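(* Let $\mathcal P$ be the Platonic solid with Schläfli symbol $\{p,q\}$ and let $\mathcal S_{\mathcal P}$ be a polytopal circle packing in $\widehat{\mathbb R^2}$ induced by $\mathcal P$. For every fundamental bend vector $\mathbf b=(b_1,b_2,b_3,b_4)^\top$ of $\mathcal S_{\mathcal P}$ one has $$Q_{\{p,q\}}(b_1,b_2,b_3,b_4)=0,$$ where $Q_{\{p,q\}}(b_1,b_2,b_3,b_4)=\mathbf b^\top \mathbf Q_{\{p,q\}}\mathbf b$ with $$\mathbf Q_{\{p,q\}}=\begin{pmatrix}1&\alpha&\beta&-1\\ \alpha&\delta&\gamma&\beta\\ \beta&\gamma&\delta&\alpha\\ -1&\beta&\alpha&1\end{pmatrix},\qquad \begin{aligned}\alpha&=-1-\omega_p-\omega_q,\\ \beta&=-1+\omega_p-\omega_q,\\ \gamma&=-1-\omega_p^2+\omega_q^2,\\ \delta&=(1+\omega_p+\omega_q)^2,\end{aligned}$$ and $\omega_n:=1+2\cos\frac{2\pi}{n}$.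
   Context: Circles. A circle (oriented) of $\widehat{\mathbb R^2}=\mathbb R^2\cup\{\infty\}$ is the image under stereographic projection from the North Pole of a spherical cap of $\mathbb S^2\subset\mathbb R^3$: a disk (positive radius), the closed exterior of a disk with $\infty$ (negative radius), or a half-plane (infinite radius). Its bend is the reciprocal of its signed radius ($0$ for a half-plane). Polytopal circle packings. For $v\in\mathbb R^3$ with $\|v\|>1$, the stereographic circle of $v$ is the image under stereographic projection of the cap $\{u\in\mathbb S^2:u\cdot v\ge1\}$. Let $\mathcal P_0$ be the canonical realisation of the Platonic solid $\mathcal P=\{p,q\}$, i.e. the regular polyhedron centred at the origin with all edges tangent to $\mathbb S^2$. A polytopal circle packing induced by $\mathcal P$ is $\mathcal S_{\mathcal P}=\mu\cdot\mathcal A_{\mathcal P_0}$, where $\mu$ is a Möbius transformation (possibly orientation-reversing) of $\widehat{\mathbb R^2}$ and $\mathcal A_{\mathcal P_0}$ is the collection of stereographic circles of the vertices of $\mathcal P_0$; the circle corresponding to a vertex $v$ is denoted $S_v$. Fundamental data. The Platonic solid $\{p,q\}$ has $p$-gonal faces, $q$ of which meet at each vertex; $\{p,q\}\in\{\{3,3\},\{3,4\},\{4,3\},\{3,5\},\{5,3\}\}$. Given a flag $\Phi=(f_0=v,f_1=e,f_2=f,f_3=\mathcal P)$ (vertex $\subset$ edge $\subset$ face $\subset\mathcal P$), the fundamental symmetry $r_i$ ($i=1,2,3$) is the reflection symmetry of $\mathcal P$ that fixes every element of $\Phi$ except $f_{i-1}$. The fundamental basis with respect to $\Phi$ is $(v_1,v_2,v_3,v_4)$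 with $v_1=f_0$, $v_2=r_1(v_1)$, $v_3=r_1r_2(v_2)$, $v_4=r_1r_2r_3(v_3)$. A fundamental bend vector of $\mathcal S_{\mathcal P}$ (with respect to $\Phi$) is the vector of bends $(b_1,b_2,b_3,b_4)^\top$ of $S_{v_1},S_{v_2},S_{v_3},S_{v_4}$. *)

(* Defs.v *)
From HB Require Import structures.
From mathcomp Require Import all_boot all_order all_algebra.
From mathcomp Require Import all_classical all_reals all_analysis.

Set Implicit Arguments.
Unset Strict Implicit.
Unset Printing Implicit Defensive.

Import Order.TTheory GRing.Theory Num.Theory.

Local Open Scope classical_set_scope.
Local Open Scope card_scope.
Local Open Scope ring_scope.

Section Euclidean.
Variables (R : realType) (n : nat).
Implicit Types (u v x a t : 'rV[R]_n) (h : R) (F : set 'rV[R]_n).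

(* The norm [`|x|] of MathComp-Analysis on matrices is the sup norm, so
   Euclidean lengths are always expressed through [dot]. *)
Definition dot u v : R := (u *m v^T) 0 0.

(* Orthogonal reflection in the hyperplane {x | x . a = h}, for a != 0. *)
Definition refl a h x : 'rV[R]_n := x - (2 * (dot x a - h) / dot a a) *: a.

Definition is_reflection (r : 'rV[R]_n -> 'rV[R]_n) :=
  exists a h, a != 0 /\ r = refl a h.

Definition is_isometry (g : 'rV[R]_n -> 'rV[R]_n) :=
  forall x y, dot (g x - g y) (g x - g y) = dot (x - y) (x - y).

Definition convex_hull (s : seq 'rV[R]_n) : set 'rV[R]_n :=
  [set x | exists c : 'I_(size s) -> R,
    [/\ forall i, 0 <= c i, \sum_i c i = 1 & x = \sum_i c i *: s`_i]].

Definition is_polytope F := exists s, F = convex_hull s.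

(* F contains x0 and the k other points x0 + row i B, which together are
   affinely independent, and F lies in their affine hull. *)
Definition has_dim (k : nat) F :=
  exists x0 (B : 'M[R]_(k, n)),
    [/\ row_free B, F x0, forall i, F (x0 + row i B)
      & forall x, F x -> (x - x0 <= B)%MS].

(* [a = 0] is allowed, so that P is a face of itself. *)
Definition is_face (k : nat) (P F : set 'rV[R]_n) :=
  has_dim k F /\
  exists a h, (forall x, P x -> dot x a <= h) /\
              F = P `&` [set x | dot x a = h].

Definition vertices (P : set 'rV[R]_n) : set 'rV[R]_n :=
  [set v | is_face 0 P [set v]].

Definition is_symmetry (P : set 'rV[R]_n) (g : 'rV[R]_n -> 'rV[R]_n) :=
  is_isometry g /\ g @` P = P.

(* F touches the unit sphere at t and lies in its tangent hyperplane at t. *)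
Definition tangent_to_sphere F :=
  exists t, [/\ F t, dot t t = 1 & forall x, F x -> dot t (x - t) = 0].

End Euclidean.

Section RegularPolyhedra.
Variable R : realType.
Notation space := 'rV[R]_3.
Implicit Types (P : set space) (Phi Psi : 'I_4 -> set space).

(* Since P is its only 3-dimensional face, a flag has Phi 3 = P; vertices occur
   in flags as singletons. *)
Definition is_flag P Phi :=
  (forall k : 'I_4, is_face k P (Phi k)) /\
  (forall j k : 'I_4, (j <= k)%N -> Phi j `<=` Phi k).

Definition is_regular_polyhedron P :=
  [/\ is_polytope P, has_dim 3 P &
      forall Phi Psi, is_flag P Phi -> is_flag P Psi ->
        exists2 g, is_symmetry P g & forall k, g @` Phi k = Psi k].

Definition has_schlafli_symbol (p q : nat) P :=
  (forall F, is_face 2 P F -> vertices P `&` F #= `I_p) /\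
  (forall v, vertices P v -> [set F | is_face 2 P F /\ F v] #= `I_q).

Definition is_platonic (p q : nat) P :=
  is_regular_polyhedron P /\ has_schlafli_symbol p q P.

Definition is_canonical_realisation (p q : nat) P :=
  [/\ is_platonic p q P,
      \sum_(v \in vertices P) v = 0
    & forall e, is_face 1 P e -> tangent_to_sphere e].

(* The flag elements are f_0, ..., f_3, so r_i moves f_(i-1). *)
Definition is_fundamental_symmetry P Phi (i : nat) (r : space -> space) :=
  [/\ is_reflection r, is_symmetry P r
    & forall j : 'I_4, (r @` Phi j = Phi j) <-> (j.+1 != i)].

Definition is_fundamental_basis P Phi (v : 'I_4 -> space) :=
  is_flag P Phi /\
  exists r1 r2 r3,
    [/\ is_fundamental_symmetry P Phi 1 r1,
        is_fundamental_symmetry P Phi 2 r2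
      & is_fundamental_symmetry P Phi 3 r3] /\
    [/\ Phi 0 = [set v 0], v 1 = r1 (v 0), v 2 = r1 (r2 (v 1))
      & v 3 = r1 (r2 (r3 (v 2)))].

End RegularPolyhedra.

Section Circles.
Variable R : realType.
Notation plane := 'rV[R]_2.
Notation space := 'rV[R]_3.

(* Underlying type [option plane], with [None] the point at infinity. *)
Definition hatR2 := one_point_compactification plane.

Definition disk (c : plane) (r : R) : set hatR2 :=
  [set z | if z is Some x then dot (x - c) (x - c) <= r ^+ 2 else False].

Definition disk_exterior (c : plane) (r : R) : set hatR2 :=
  [set z | if z is Some x then r ^+ 2 <= dot (x - c) (x - c) else True].

Definition half_plane (a : plane) (h : R) : set hatR2 :=
  [set z | if z is Some x then dot x a <= h else True].

(* [has_bend C b]: C is an oriented circle (identified with the closed region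
   it bounds) and b is its bend. *)
Variant has_bend : set hatR2 -> R -> Prop :=
| BendDisk c r : 0 < r -> has_bend (disk c r) r^-1
| BendExterior c r : 0 < r -> has_bend (disk_exterior c r) (- r)^-1
| BendHalfPlane a h : a != 0 -> has_bend (half_plane a h) 0.

Definition circle_inversion (c : plane) (r : R) (z : hatR2) : hatR2 :=
  if z is Some x then
    if x == c then None
    else Some (c + (r ^+ 2 / dot (x - c) (x - c)) *: (x - c))
  else Some c.

Definition line_reflection (a : plane) (h : R) (z : hatR2) : hatR2 :=
  if z is Some x then Some (refl a h x) else None.

(* The full Moebius group, orientation-reversing maps included, is generated by
   the inversions in circles and the reflections in lines. *)
Inductive is_moebius : (hatR2 -> hatR2) -> Prop :=
| MoebiusId : is_moebius idfun
| MoebiusInversion c r mu :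
    0 < r -> is_moebius mu -> is_moebius (circle_inversion c r \o mu)
| MoebiusReflection a h mu :
    a != 0 -> is_moebius mu -> is_moebius (line_reflection a h \o mu).

(* Projection from (0, 0, 1) onto the equatorial plane:
   (x, y, z) |-> (x, y) / (1 - z). *)
Definition stereographic (u : space) : hatR2 :=
  if u 0 ord_max == 1 then None
  else Some ((1 - u 0 ord_max)^-1 *: (col' ord_max u : plane)).

Definition cap (v : space) : set space :=
  [set u | dot u u = 1 /\ 1 <= dot u v].

Definition stereographic_circle (v : space) : set hatR2 :=
  stereographic @` cap v.

(* S v is the circle of the packing that corresponds to the vertex v of P. *)
Definition is_polytopal_packing (P : set space) (S : space -> set hatR2) :=
  exists2 mu, is_moebius mu &
    forall v, vertices P v -> S v = mu @` stereographic_circle v.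

Definition is_fundamental_bend_vector (P : set space)
    (S : space -> set hatR2) (b : 'cV[R]_4) :=
  exists Phi v, is_fundamental_basis P Phi v /\
    forall i, has_bend (S (v i)) (b i 0).

End Circles.

Section QuadraticForm.
Variables (R : realType).

Definition omega (n : nat) : R := 1 + 2 * cos (2 * pi / n%:R).

Definition Qmx (p q : nat) : 'M[R]_4 :=
  let alpha := -1 - omega p - omega q in
  let beta := -1 + omega p - omega q in
  let gamma := -1 - omega p ^+ 2 + omega q ^+ 2 in
  let delta := (1 + omega p + omega q) ^+ 2 in
  \matrix_(i < 4, j < 4)
    (nth [::] [:: [:: 1;     alpha; beta;  -1   ];
                  [:: alpha; delta; gamma; beta ];
                  [:: beta;  gamma; delta; alpha];
                  [:: -1;    beta;  alpha; 1    ]] i)`_j.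

Definition Qform (p q : nat) (b : 'cV[R]_4) : R := (b^T *m Qmx p q *m b) 0 0.

End QuadraticForm.

(* Main.v *)
Require Import Defs.
From mathcomp Require Import all_boot all_order all_algebra.
From mathcomp Require Import all_classical all_reals all_analysis.
From mathcomp Require Import ring lra.

(** The proof has a Lorentzian half and a combinatorial half.

    Lorentzian half. A circle is given by the coefficients of its equation, a
    vector of positive norm in Lorentzian 4-space, and its bend is the leading
    coefficient after normalisation. The circle of a point v outside the sphere
    corresponds to (v, 1), of norm [dot v v - 1]. Evaluating the equation of a
    circle at a point is a null functional, the leading coefficient being the
    evaluation at infinity, and a Moebius transformation turns evaluation at a
    point into evaluation at its preimage, up to a positive factor independent of
    the circle ([moebius_circ]). Hence the bends of all vertices of a packing are,
    up to one common factor, the values [dot v N - n0] of a null functional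
    ([packing_bends]). As the matrix of the quadratic form is proportional to the
    inverse of the Gram matrix of the four vectors (v_i, 1), the form computes the
    norm of this functional, which is 0 ([bend_form_eq0]).

    Combinatorial half. The Gram matrix has to be found from the Schlaefli symbol.
    The fundamental symmetries preserve the centroid of the vertices, so they are
    mirrors through 0 with unit normals e1, e2, e3; the first and the last are
    orthogonal ([e1_perp3]), and v is orthogonal to e2 and e3. Everything is thus
    determined by the two angles between consecutive mirrors and by the
    circumradius. The latter is fixed by the tangency of the edges
    ([edge_tangent], [circumradius]). For the angles, one has to exclude star
    polygons and other ways in which the orbit of a vertex might fail to be the
    boundary of the polygon. This is done once, for a finite mirror-symmetric set
    of exposed points with an edge ([polygon_angle]), and used twice: for the
    vertices of a face ([vertex_angle_face]), and for the normals of the faces at a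
    vertex, that is the dual face of the polar polyhedron
    ([vertex_angle_figure]). *)

Set Implicit Arguments.
Unset Strict Implicit.
Unset Printing Implicit Defensive.

Import Order.TTheory GRing.Theory Num.Theory.

Local Open Scope ring_scope.

(** * The Euclidean dot product and mirrors *)

Section Vectors.
Variables (R : realType) (n : nat).
Implicit Types (u v x a e : 'rV[R]_n) (k : R).

Lemma dotE u v : dot u v = \sum_j u 0 j * v 0 j.
Proof. by rewrite /dot mxE; apply: eq_bigr => j _; rewrite mxE. Qed.

Lemma dotC u v : dot u v = dot v u.
Proof. by rewrite !dotE; apply: eq_bigr => j _; rewrite mulrC. Qed.

Lemma dotDl u v x : dot (u + v) x = dot u x + dot v x.
Proof. by rewrite /dot mulmxDl mxE. Qed.

Lemma dotZl k u x : dot (k *: u) x = k * dot u x.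
Proof. by rewrite /dot -scalemxAl mxE. Qed.

Lemma dotNl u x : dot (- u) x = - dot u x.
Proof. by rewrite -scaleN1r dotZl mulN1r. Qed.

Lemma dotDr u v x : dot x (u + v) = dot x u + dot x v.
Proof. by rewrite !(dotC x) dotDl. Qed.

Lemma dotZr k u x : dot x (k *: u) = k * dot x u.
Proof. by rewrite !(dotC x) dotZl. Qed.

Lemma dotNr u x : dot x (- u) = - dot x u.
Proof. by rewrite !(dotC x) dotNl. Qed.

Lemma dot0l x : dot 0 x = 0.
Proof. by rewrite -(scale0r x) dotZl mul0r. Qed.

Lemma dot0r x : dot x 0 = 0.
Proof. by rewrite dotC dot0l. Qed.

Definition dot_lin := (dotDl, dotDr, dotZl, dotZr, dotNl, dotNr, dot0l, dot0r).

Lemma dot_suml I (r : seq I) (F : I -> 'rV[R]_n) x :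
  dot (\sum_(i <- r) F i) x = \sum_(i <- r) dot (F i) x.
Proof. by elim/big_rec2: _ => [|i a v _ IH]; rewrite ?dot0l // dotDl IH. Qed.

Lemma dot_ge0 x : 0 <= dot x x.
Proof. by rewrite dotE sumr_ge0 // => j _; rewrite -expr2 sqr_ge0. Qed.

Lemma dot_eq0 x : (dot x x == 0) = (x == 0).
Proof.
apply/eqP/eqP => [|->]; last exact: dot0l.
rewrite dotE => /eqP; rewrite psumr_eq0 => [/allP x0|j _]; last first.
  by rewrite -expr2 sqr_ge0.
apply/rowP => j; rewrite mxE; apply/eqP.
by have := x0 j (mem_index_enum _); rewrite /= mulf_eq0 orbb.
Qed.

Lemma dot_gt0 x : (0 < dot x x) = (x != 0).
Proof. by rewrite lt_def dot_ge0 andbT dot_eq0. Qed.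

(** The equality case of the Cauchy-Schwarz inequality. *)
Lemma unit_parallel u v :
  dot u u = 1 -> dot v v = 1 -> dot u v ^+ 2 = 1 -> u = dot u v *: v.
Proof.
move=> u1 v1 uv; apply/eqP; rewrite -subr_eq0 -dot_eq0; apply/eqP.
rewrite !dot_lin (dotC v u) u1 v1.
by transitivity (1 - dot u v ^+ 2); [ring | rewrite uv subrr].
Qed.

Definition mirror e x : 'rV[R]_n := x - (2 * dot x e) *: e.

Lemma mirror_id e x : dot x e = 0 -> mirror e x = x.
Proof. by move=> xe; rewrite /mirror xe mulr0 scale0r subr0. Qed.

Lemma dot_mirrorE e x y : dot (mirror e x) y = dot x y - 2 * dot x e * dot e y.
Proof. by rewrite /mirror dotDl dotNl dotZl. Qed.

Section Mirror.
Variables (e : 'rV[R]_n) (e1 : dot e e = 1).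

Lemma mirrorK : involutive (mirror e).
Proof.
move=> x; rewrite /mirror !dot_lin e1 -addrA -opprD -scalerDl.
suff -> : 2 * dot x e + 2 * (dot x e - 2 * dot x e * 1) = 0.
  by rewrite scale0r subr0.
by ring.
Qed.

Lemma mirror_inj : injective (mirror e).
Proof. exact: inv_inj mirrorK. Qed.

Lemma mirror_fixed x : mirror e x = x -> dot x e = 0.
Proof.
move=> /(congr1 (fun y => dot y e)); rewrite /mirror !dot_lin e1.
by move: (dot x e) => t; lra.
Qed.

Lemma mirrorD x y : mirror e (x + y) = mirror e x + mirror e y.
Proof. by rewrite /mirror dotDl mulrDr scalerDl opprD addrACA. Qed.

Lemma mirrorZ k x : mirror e (k *: x) = k *: mirror e x.
Proof. by rewrite /mirror dotZl scalerBr scalerA mulrCA. Qed.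

Lemma mirrorN x : mirror e (- x) = - mirror e x.
Proof. by rewrite -scaleN1r mirrorZ scaleN1r. Qed.

Lemma mirrorB x y : mirror e (x - y) = mirror e x - mirror e y.
Proof. by rewrite mirrorD mirrorN. Qed.

Lemma dot_mirror x y : dot (mirror e x) y = dot x (mirror e y).
Proof. by rewrite /mirror !dot_lin (dotC e y); ring. Qed.

Lemma mirror_isom x y : dot (mirror e x) (mirror e y) = dot x y.
Proof. by rewrite dot_mirror mirrorK. Qed.

End Mirror.

Lemma mirror_parallel u v k x : dot u u = 1 -> dot v v = 1 ->
  u = k *: v -> mirror u x = mirror v x.
Proof.
move=> u1 v1 uv; have kk : k * k = 1 by rewrite -u1 uv !dot_lin v1 mulr1.
rewrite /mirror uv dotZr.
by rewrite scalerA -mulrA (mulrAC k) kk mul1r.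
Qed.

End Vectors.

(** * Orthogonality in dimension three *)

Section Space.
Variable R : realType.
Implicit Types (v e d : 'rV[R]_3).

(** The Gram matrix of four nonzero pairwise orthogonal vectors is diagonal and
    invertible, whereas a product through dimension 3 has rank at most 3. *)
Lemma no_four_orthogonal (E : 'M[R]_(4, 3)) :
  (forall i j, i != j -> dot (row i E) (row j E) = 0) ->
  exists i, row i E = 0.
Proof.
move=> orth; apply: contrapT => /forallNP nz.
have EE : E *m E^T = diag_mx (\row_i dot (row i E) (row i E)).
  apply/matrixP => i j.
  have -> : (E *m E^T) i j = dot (row i E) (row j E).
    by rewrite !dotE mxE; apply: eq_bigr => k _; rewrite !mxE.
  rewrite mxE; case: (eqVneq i j) => [->|/orth ->]; last by rewrite mulr0n.
  by rewrite mxE mulr1n.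
have : (\rank (E *m E^T) <= 3)%N.
  exact: leq_trans (mxrankM_maxl _ _) (rank_leq_col _).
rewrite EE mxrank_unit // unitmxE det_diag unitfE.
by apply/prodf_neq0 => i _; rewrite mxE dot_eq0; apply/eqP/nz.
Qed.

Lemma perp3_eq0 v e f d : v != 0 -> dot e e = 1 -> dot f f = 1 ->
  dot e f ^+ 2 != 1 -> dot v e = 0 -> dot v f = 0 ->
  dot d v = 0 -> dot d e = 0 -> dot d f = 0 -> d = 0.
Proof.
move=> v0 e1 f1 ef ve vf dv de df.
(* With g the Gram-Schmidt correction of f, the vectors d, v, e, g are pairwise
   orthogonal, so one of them is 0; only d can be. *)
pose g := f - dot e f *: e.
pose E := \matrix_(i < 4) nth 0 [:: d; v; e; g] i.
have rE i : row i E = nth 0 [:: d; v; e; g] i by rewrite rowK.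
have orth (i j : 'I_4) : (i < j)%N -> dot (row i E) (row j E) = 0.
  rewrite !rE; case: i => [[|[|[|[]]]]] //= _; case: j => [[|[|[|[]]]]] //= _ _;
  by rewrite /g !dot_lin ?dv ?de ?df ?ve ?vf ?e1 ?f1; ring.
case: (@no_four_orthogonal E) => [i j|i].
  by rewrite -val_eqE neq_ltn => /orP[/orth //|/orth]; rewrite dotC.
rewrite rE; case: i => [[|[|[|[]]]]] //= _.
- by move=> v00; rewrite v00 eqxx in v0.
- by move=> e0; move: e1; rewrite e0 dot0l => /eqP; rewrite eq_sym oner_eq0.
- move=> /(congr1 (fun x => dot x x)); rewrite /g !dot_lin e1 f1 (dotC f e).
  by move=> H; case/eqP: ef; move: H; move: (dot e f) => t; lra.
Qed.

Lemma decompose3 v e f x : v != 0 -> dot e e = 1 -> dot f f = 1 ->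
  dot e f ^+ 2 != 1 -> dot v e = 0 -> dot v f = 0 ->
  exists c2 c3, x = (dot x v / dot v v) *: v + c2 *: e + c3 *: f.
Proof.
move=> v0 e1 f1 ef ve vf.
have vv : dot v v != 0 by rewrite dot_eq0.
have D0 : 1 - dot e f ^+ 2 != 0 by rewrite subr_eq0 eq_sym.
exists ((dot x e - dot e f * dot x f) / (1 - dot e f ^+ 2)).
exists ((dot x f - dot e f * dot x e) / (1 - dot e f ^+ 2)).
apply/eqP; rewrite -subr_eq0; apply/eqP.
have [ev fv fe] : [/\ dot e v = 0, dot f v = 0 & dot f e = dot e f].
  by rewrite !(dotC _ v) ve vf (dotC f).
by apply: (perp3_eq0 v0 e1 f1 ef ve vf); rewrite !dot_lin ?e1 ?f1 ?ev ?fv ?fe ?ve ?vf; field; rewrite ?vv ?D0.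
Qed.

Lemma perp_span v e f x : v != 0 -> dot e e = 1 -> dot f f = 1 ->
  dot e f ^+ 2 != 1 -> dot v e = 0 -> dot v f = 0 -> dot x v = 0 ->
  exists c2 c3, x = c2 *: e + c3 *: f.
Proof.
move=> v0 e1 f1 ef ve vf xv.
have [c2 [c3 E]] := decompose3 x v0 e1 f1 ef ve vf.
by exists c2, c3; rewrite [LHS]E xv mul0r scale0r add0r.
Qed.

End Space.

(** * The values of omega *)

Section Angles.
Variable R : realType.

Lemma cos_lt1 (x : R) : 0 < x < pi -> cos x < 1.
Proof.
move=> /andP[x0 xpi]; rewrite lt_neqAle cos_le1 andbT; apply/eqP.
rewrite -[1]cos0 => /cos_inj x00.
have x0E : x = 0 by apply: x00; rewrite in_itv /= ?lexx ?pi_ge0 ?(ltW x0) ?(ltW xpi).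
by rewrite x0E ltxx in x0.
Qed.

Lemma two_pi_div_itv (n : nat) : (2 < n)%N -> 0 < 2 * (pi : R) / n%:R < pi.
Proof.
move=> n2; have n0 : 0 < n%:R :> R by rewrite ltr0n (leq_trans _ n2).
have p0 := pi_gt0 R; rewrite divr_gt0 ?mulr_gt0 //=.
by rewrite ltr_pdivrMr // mulrC ltr_pM2l // (ltr_nat R 2 n).
Qed.

Lemma cos_triple (x : R) : cos (x *+ 3) = 4 * cos x ^+ 3 - 3 * cos x.
Proof.
rewrite mulrS cosD cos_mulr2n sin_mulr2n.
rewrite (_ : sin x * _ = (1 - cos x ^+ 2) * cos x *+ 2); first by ring.
by rewrite -sin2cos2; ring.
Qed.

Lemma omega3 : omega R 3 = 0.
Proof.
have /cos_lt1 := two_pi_div_itv (isT : (2 < 3)%N).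
have : cos ((2 * pi / 3%:R) *+ 3) = 1 :> R.
  by rewrite -[RHS]cos2pi; congr cos; field.
rewrite cos_triple /omega; move: (cos _) => t H t1.
have : (t - 1) * (1 + 2 * t) ^+ 2 = 0 by lra.
by move/eqP; rewrite mulf_eq0 sqrf_eq0 => /orP[/eqP|/eqP //]; lra.
Qed.

Lemma omega4 : omega R 4 = 1.
Proof.
rewrite /omega (_ : 2 * pi / 4%:R = pi / 2 :> R); last by field.
by rewrite cos_pihalf mulr0 addr0.
Qed.

(** The equation, obtained from cos (3 t) = cos (2 t) at t = 2 pi / 5, has the
    root 1 + omega 5 for the convex pentagon and its inverse for the star
    pentagon; the sign of omega 5 separates them. *)
Lemma omega5 : 0 < omega R 5 /\ (1 + omega R 5) ^+ 2 - 3 * (1 + omega R 5) + 1 = 0.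
Proof.
have a1 := two_pi_div_itv (isT : (2 < 5)%N).
have := cos_lt1 a1; set a := 2 * pi / 5%:R in a1 *.
have p0 := pi_gt0 R.
have c0 : 0 < cos a by apply: cos_gt0_pihalf; rewrite /a; apply/andP; split; lra.
have : cos (a *+ 3) = cos (a *+ 2).
  by rewrite (_ : a *+ 3 = - (a *+ 2) + pi *+ 2) ?cosD2pi ?cosN // /a; field.
rewrite cos_triple cos_mulr2n /omega -/a; move: (cos a) c0 => t t0 H t1.
have : (t - 1) * (4 * t ^+ 2 + 2 * t - 1) = 0.
  by lra.
move/eqP; rewrite mulf_eq0 => /orP[/eqP|/eqP E]; first by lra.
by split; [lra | rewrite -E; ring].
Qed.

End Angles.

(** * A mirror-symmetric convex polygon is regular *)

Section Polygon.
Variables (R : realType) (n : nat).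
Implicit Types (x y a c e f : 'rV[R]_n) (s : seq 'rV[R]_n).

Definition exposed_in s y := exists c, forall x, x \in s -> x != y -> dot x c < dot y c.

(** The finite set s is thought of as the vertex set of a convex polygon with
    vertex a, symmetric under two mirrors: the mirror of f fixes a, and the mirror
    of e exchanges the ends of an edge at a, on which the functional of c is maximal
    over s. With a2 = e(a), a0 = f(a2) and a3 = e(a0), the points a0, a, a2, a3 are
    consecutive vertices; for a triangle a3 = a0. *)
Section Orbit.
Variables (s : seq 'rV[R]_n) (e f a c : 'rV[R]_n).
Hypotheses (e1 : dot e e = 1) (f1 : dot f f = 1).
Hypotheses (us : uniq s) (sa : a \in s).
Hypothesis se : forall x, x \in s -> mirror e x \in s.
Hypothesis sf : forall x, x \in s -> mirror f x \in s.
Hypotheses (af : dot a f = 0) (ae : dot a e != 0).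
Hypotheses (ef0 : dot e f != 0) (ef1 : dot e f ^+ 2 != 1).
Hypothesis plane : forall x, x \in s -> exists k l, x = a + (k *: e + l *: f).
Hypothesis exposed : forall y, y \in s -> exposed_in s y.
Hypotheses (ec : dot e c = 0) (fc : dot f c != 0).
Hypothesis edge : forall x, x \in s -> dot x c <= dot a c.

Let u := dot e f.
Let k := 2 * dot a e.
Let a2 := mirror e a.
Let a0 := mirror f a2.
Let a3 := mirror e a0.

Let k0 : k != 0. Proof. by rewrite mulf_neq0 // pnatr_eq0. Qed.

Let fe : dot f e = u. Proof. exact: dotC. Qed.

Let a2E : a2 = a - k *: e. Proof. by []. Qed.

Let a0E : a0 = a - k *: e + (2 * k * u) *: f.
Proof.
rewrite /a0 /mirror a2E !dot_lin af -/u; congr (_ + _).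
by rewrite -scaleNr; congr (_ *: _); ring.
Qed.

Let a0e : dot a0 e = k / 2 * (4 * u ^+ 2 - 1).
Proof. by rewrite a0E !dot_lin e1 fe /k; field. Qed.

Let a3E : a3 = a0 - (k * (4 * u ^+ 2 - 1)) *: e.
Proof. by rewrite /a3 /mirror a0e; congr (_ - _ *: _); field. Qed.

Let a3f : dot a3 f = k * u * (2 - 4 * u ^+ 2).
Proof. by rewrite a3E a0E !dot_lin af f1 -/u; ring. Qed.

Let sa2 : a2 \in s. Proof. exact: se. Qed.
Let sa0 : a0 \in s. Proof. exact: sf. Qed.
Let sa3 : a3 \in s. Proof. exact: se. Qed.

Let a2a : a2 != a.
Proof. by apply: contraNneq ae => /(mirror_fixed e1) ->. Qed.

Let a0a2 : a0 != a2.
Proof.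
apply/eqP => /(mirror_fixed f1); rewrite a2E !dot_lin af -/u => /eqP.
by rewrite add0r oppr_eq0 mulf_eq0 (negPf k0) (negPf ef0).
Qed.

Let fa : mirror f a = a. Proof. exact: mirror_id. Qed.

Let a0a : a0 != a.
Proof. by rewrite -[X in _ != X]fa (inj_eq (mirror_inj f1)). Qed.

Let a3a : a3 != a.
Proof. by rewrite -[X in _ != X](mirrorK e1) (inj_eq (mirror_inj e1)). Qed.

Let a3a2 : a3 != a2.
Proof. by rewrite (inj_eq (mirror_inj e1)). Qed.

Let a3a0 : (a3 == a0) = (4 * u ^+ 2 == 1).
Proof.
apply/eqP/eqP => [/(mirror_fixed e1)|x1].
  by rewrite a0e => /eqP; rewrite mulf_eq0 (negPf (_ : k / 2 != 0)) ?subr_eq0 ?mulf_neq0 ?invr_neq0 ?pnatr_eq0 // => /eqP.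
by apply: mirror_id; rewrite a0e x1 subrr mulr0.
Qed.

Let uniq3 : uniq [:: a; a2; a0].
Proof. by rewrite /= !inE negb_or !(eq_sym a) a2a a0a eq_sym a0a2. Qed.

Let uniq4 : 4 * u ^+ 2 != 1 -> uniq [:: a3; a; a2; a0].
Proof. by rewrite cons_uniq uniq3 andbT !inE !negb_or a3a a3a2 a3a0 => ->. Qed.

Let center_uniq x y : x \in s -> y \in s ->
  dot x e = 0 -> dot x f = 0 -> dot y e = 0 -> dot y f = 0 -> x = y.
Proof.
move=> /plane[k1 [l1 ->]] /plane[k2 [l2 ->]]; rewrite !dot_lin e1 f1 af fe -/u.
have u1 : 1 - u ^+ 2 != 0 by rewrite subr_eq0 eq_sym.
move=> A B C D.
have k1E : k1 = - dot a e - l1 * u by lra.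
have k2E : k2 = - dot a e - l2 * u by lra.
have E : l1 = l2 by apply: (mulfI u1); move: B D; rewrite k1E k2E; lra.
by rewrite k1E k2E E.
Qed.

(** The only point of s that both mirrors can fix is the centre of the polygon,
    which is then a barycentre of vertices with nonnegative weights, so it is not
    exposed. *)
Let center_notin y : 4 * u ^+ 2 <= 2 -> y \in s -> dot y e = 0 -> dot y f = 0 -> False.
Proof.
move=> x2 sy ye yf; have [g ming] := exposed sy.
have [y1 [y2 yE]] := plane sy.
have gt z : z \in s -> dot z e != 0 \/ dot z f != 0 -> dot z g < dot y g.
  by move=> sz H; apply: ming => //; apply/eqP => zy; case: H; rewrite zy ?ye ?yf eqxx.
have gta : dot a g < dot y g by apply: gt => //; left.
have uk : k * u != 0 by rewrite mulf_neq0.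
have gta2 : dot a2 g < dot y g.
  apply: gt => //; right; rewrite a2E !dot_lin af -/u sub0r oppr_eq0 //.
have gta0 : dot a0 g < dot y g.
  apply: gt => //; right; rewrite a0E !dot_lin af f1 -/u.
  by rewrite (_ : _ + _ = k * u) //; ring.
have y2E : y2 = - (y1 * u).
  by move: yf; rewrite yE !dot_lin af f1 -/u => H; lra.
have y1E : y1 * (1 - u ^+ 2) = - (k / 2).
  by move: ye; rewrite yE !dot_lin e1 fe y2E /k => H; lra.
have yg : dot y g = dot a g + y1 * (dot e g - u * dot f g).
  by rewrite yE !dot_lin y2E; ring.
(* The point y is the barycentre of a0, a2 and a with weights 1, 1, 2 - 4u^2. *)
have : dot a0 g + dot a2 g + (2 - 4 * u ^+ 2) * dot a g = (4 - 4 * u ^+ 2) * dot y g.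
  have -> : (4 - 4 * u ^+ 2) * dot y g = (4 - 4 * u ^+ 2) * dot a g
     + 4 * (y1 * (1 - u ^+ 2)) * (dot e g - u * dot f g) by rewrite yg; ring.
  by rewrite y1E a0E a2E !dot_lin; field.
have : (2 - 4 * u ^+ 2) * dot a g <= (2 - 4 * u ^+ 2) * dot y g.
  by rewrite ler_wpM2l ?subr_ge0 // ltW.
lra.
Qed.


Let outside (g : 'rV[R]_n) (T : seq 'rV[R]_n) y : dot g g = 1 ->
  {in T, forall z, mirror g z \in T} -> y \notin T -> mirror g y \notin T.
Proof. by move=> g1 Tg; apply: contra => /Tg; rewrite mirrorK. Qed.

Let another (T : seq 'rV[R]_n) : (size T < size s)%N ->
  exists2 y, y \in s & y \notin T.
Proof.
move=> Ts; apply/hasP; apply: contraLR Ts; rewrite -all_predC -leqNgt => /allP sT.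
by apply: uniq_leq_size us _ => x /sT; rewrite /= negbK.
Qed.

Let exhaust (T : seq 'rV[R]_n) : uniq T -> all (mem s) T -> size T = size s ->
  forall x, x \in s -> x \in T.
Proof.
move=> uT /allP Ts sz x; have szle : (size s <= size T)%N by rewrite sz.
by have [_ ->] := uniq_min_size uT Ts szle.
Qed.

Let e_orbit3 : 4 * u ^+ 2 = 1 ->
  {in [:: a; a2; a0], forall z, mirror e z \in [:: a; a2; a0]}.
Proof.
move=> x1 z; rewrite !inE => /or3P[] /eqP ->; rewrite ?eqxx ?orbT //.
  by rewrite /a2 mirrorK // eqxx.
by move/eqP: x1; rewrite -a3a0 /a3 => ->; rewrite !orbT.
Qed.

Let f_orbit3 : {in [:: a; a2; a0], forall z, mirror f z \in [:: a; a2; a0]}.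
Proof.
move=> z; rewrite !inE => /or3P[] /eqP ->; rewrite ?fa ?eqxx ?orbT //.
by rewrite /a0 mirrorK // eqxx orbT.
Qed.

Let e_orbit4 : {in [:: a3; a; a2; a0], forall z, mirror e z \in [:: a3; a; a2; a0]}.
Proof.
move=> z; rewrite !inE => /or4P[] /eqP ->; rewrite ?eqxx ?orbT //.
  by rewrite /a3 mirrorK // eqxx !orbT.
by rewrite /a2 mirrorK // eqxx !orbT.
Qed.

Let f_a3_fixed : mirror f a3 = a3 -> 4 * u ^+ 2 = 2.
Proof.
move/(mirror_fixed f1); rewrite a3f => /eqP.
by rewrite 2!mulf_eq0 (negPf k0) (negPf ef0) subr_eq0 => /eqP ->.
Qed.

Let f_a3 : 4 * u ^+ 2 != 1 -> mirror f a3 \notin [:: a; a2; a0].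
Proof.
by move=> x1; apply: outside => //; rewrite !inE !negb_or a3a a3a2 a3a0.
Qed.

Let a3e : dot a3 e = - (k / 2 * (4 * u ^+ 2 - 1)).
Proof. by rewrite /a3 (dot_mirror e a0) /mirror e1 dotDr dotNr dotZr a0e; ring. Qed.

Let a0c : dot a0 c = dot a c + 2 * k * u * dot f c.
Proof. by rewrite a0E !dot_lin ec; ring. Qed.

Let a3c : dot a3 c = dot a c + 2 * k * u * dot f c.
Proof. by rewrite a3E dotDl dotNl dotZl a0c ec; ring. Qed.

(** The algebra alone gives a regular pentagon or a star pentagon; in a star
    pentagon the line through a and a2 has vertices strictly on both sides,
    contrary to [edge]. *)
Let pentagon : dot (mirror f a3) e = 0 -> mirror f a3 \in s ->
  4 * u ^+ 2 = 1 + omega R 5.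
Proof.
move=> + /edge; have := edge sa0.
rewrite (dot_mirrorE f a3 e) (dot_mirrorE f a3 c) a3f a3e a0c a3c fe.
set m := 2 * k * u * dot f c => gt0 H gty.
have x_eq : (4 * u ^+ 2) ^+ 2 - 3 * (4 * u ^+ 2) + 1 = 0.
  by apply: (mulfI k0); lra.
have m0 : m < 0.
  rewrite lt_neqAle !mulf_neq0 ?pnatr_eq0 //=.
  by move: gt0; rewrite /m; lra.
have mx : m * (4 * u ^+ 2 - 1) <= 0 by move: gty; rewrite /m; lra.
have {mx} x1 : 1 <= 4 * u ^+ 2 by move: mx; rewrite nmulr_rle0 // subr_ge0.
have [] := omega5 R; move: (4 * u ^+ 2) (omega R 5) x_eq x1 => x w x_eq x1 w0 w_eq.
have : (x - (1 + w)) * (x + w - 2) = 0 by lra.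
by move/eqP; rewrite mulf_eq0 => /orP[/eqP|/eqP xw]; [lra | nra].
Qed.

(** Each mirror fixes or exchanges the two points outside a triangular orbit, and
    in every combination the two points would coincide. *)
Let no_pair y y' : uniq [:: y; y'; a; a2; a0] -> y \in s -> y' \in s ->
  (forall x, x \in s -> x \in [:: y; y'; a; a2; a0]) -> 4 * u ^+ 2 = 1 -> False.
Proof.
move=> T5 sy sy' exh x1; move: T5; rewrite !cons_uniq in_cons negb_or => /and3P[].
move=> /andP[yy' yT] y'T _.
have pair g z : dot g g = 1 -> {in s, forall x, mirror g x \in s} ->
    {in [:: a; a2; a0], forall x, mirror g x \in [:: a; a2; a0]} ->
    z \in s -> z \notin [:: a; a2; a0] -> mirror g z = y \/ mirror g z = y'.
  move=> g1 sg gT sz zT; have := exh _ (sg _ sz).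
  rewrite !(in_cons y) !(in_cons y') (negPf (outside g1 gT zT)) orbF.
  by case/orP => /eqP; [left | right].
have fixed_pair g : dot g g = 1 -> {in s, forall x, mirror g x \in s} ->
    {in [:: a; a2; a0], forall x, mirror g x \in [:: a; a2; a0]} ->
    (dot y g = 0 /\ dot y' g = 0) \/ mirror g y = y'.
  move=> g1 sg gT; have [gy|] := pair g y g1 sg gT sy yT; last by right.
  left; have [gy'|gy'] := pair g y' g1 sg gT sy' y'T.
    by move/eqP: yy'; rewrite -gy in gy'; case; move/(mirror_inj g1): gy'.
  by split; apply: (mirror_fixed g1).
have moved g : mirror g y = y' -> dot y g <> 0.
  by move=> gy yg; case/eqP: yy'; rewrite -gy mirror_id.
have [[ye y'e]|ey] := fixed_pair e e1 se (e_orbit3 x1);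
  have [[yf y'f]|fy] := fixed_pair f f1 sf f_orbit3.
- by case/eqP: yy'; apply: center_uniq.
- apply: (moved f fy); apply: (mulIf ef0); move: y'e.
  by rewrite -fy dot_mirrorE ye fe /u mul0r; lra.
- apply: (moved e ey); apply: (mulIf ef0); move: y'f.
  by rewrite -ey dot_mirrorE yf /u mul0r; lra.
- apply: (moved f fy).
  have E g : dot (mirror e y) g = dot (mirror f y) g by rewrite ey fy.
  move: (E e) (E f); rewrite !dot_mirrorE e1 f1 fe -/u => Ee Ef.
  have D0 : 1 - u ^+ 2 != 0 by rewrite subr_eq0 eq_sym.
  have yeE : dot y e = dot y f * u by lra.
  by apply: (mulIf D0); move: Ef; rewrite yeE; lra.
Qed.

(** With p points the orbit a0, a, a2, a3 leaves at most one or two others, which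
    are forced to be fixed by a mirror or to continue the orbit; each way of
    closing up the orbit is one polynomial equation for the cosine of the angle
    between the mirrors. The left side is the squared ratio of the distance
    from a to a3 to the edge length. *)
Lemma polygon_angle p : p = size s -> p \in [:: 3; 4; 5]%N ->
  4 * dot e f ^+ 2 = 1 + omega R p.
Proof.
rewrite -/u => -> p345.
have S3 y : y \in s -> all (mem s) [:: y; a; a2; a0].
  by move=> sy; rewrite /= sy sa sa2 sa0.
have [x1|x1] := eqVneq (4 * u ^+ 2) 1; last first.
  have T4 := uniq4 x1; have := uniq_leq_size T4 (allP (S3 _ sa3)).
  move: p345; rewrite !inE => /or3P[] /eqP sz; rewrite sz // => _.
    have := exhaust T4 (S3 _ sa3) (esym sz) (sf sa3).
    rewrite in_cons (negPf (f_a3 x1)) orbF => /eqP /f_a3_fixed ->.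
    by rewrite omega4.
  have [|y sy yT] := @another [:: a3; a; a2; a0]; first by rewrite sz.
  have T5 : uniq [:: y; a3; a; a2; a0] by rewrite cons_uniq yT.
  have sT : all (mem s) [:: y; a3; a; a2; a0] by rewrite /= sy sa3 sa sa2 sa0.
  have exh := exhaust T5 sT (esym sz).
  have ye : dot y e = 0.
    apply: (mirror_fixed e1); apply/eqP; have := exh _ (se sy).
    by rewrite in_cons (negPf (outside e1 e_orbit4 yT)) orbF.
  have := exh _ (sf sa3); rewrite !(in_cons y) !(in_cons a3) => /orP[/eqP fa3|].
    by apply: pentagon; [rewrite fa3 | exact: sf].
  rewrite (negPf (f_a3 x1)) orbF => /eqP fa3.
  have x2 := f_a3_fixed fa3.
  have f_orbit4 : {in [:: a3; a; a2; a0], forall z, mirror f z \in [:: a3; a; a2; a0]}.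
    move=> z; rewrite in_cons => /orP[/eqP ->|/f_orbit3 zT].
      by rewrite fa3 mem_head.
    by rewrite in_cons zT orbT.
  exfalso; apply: (center_notin _ sy ye); first by rewrite x2.
  apply: (mirror_fixed f1); apply/eqP; have := exh _ (sf sy).
  by rewrite in_cons (negPf (outside f1 f_orbit4 yT)) orbF.
have eT := e_orbit3 x1.
move: p345; rewrite !inE => /or3P[] /eqP sz; rewrite sz ?omega3 ?addr0 //; exfalso.
  have [|y sy yT] := @another [:: a; a2; a0]; first by rewrite sz.
  have T4 : uniq [:: y; a; a2; a0] by rewrite cons_uniq yT.
  have exh := exhaust T4 (S3 _ sy) (esym sz).
  apply: (@center_notin y); rewrite ?x1 ?ler1n //; apply: mirror_fixed => //; apply/eqP.
    by have := exh _ (se sy); rewrite in_cons (negPf (outside e1 eT yT)) orbF.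
  by have := exh _ (sf sy); rewrite in_cons (negPf (outside f1 f_orbit3 yT)) orbF.
have [|y' sy' y'T] := @another [:: a; a2; a0]; first by rewrite sz.
have [|y sy yT] := @another [:: y'; a; a2; a0]; first by rewrite sz.
have T5 : uniq [:: y; y'; a; a2; a0] by rewrite !cons_uniq yT y'T.
apply: (no_pair T5 sy sy') => //; apply: exhaust => //.
by rewrite /= sy sy' sa sa2 sa0.
Qed.

End Orbit.
End Polygon.

(** * The quadratic form vanishes on null functionals *)

Section FormIdentity.
Variable R : realType.

Lemma Qform_expand p q (b : 'cV[R]_4) (x y z t : R) :
  b 0 0 = x -> b 1 0 = y -> b 2 0 = z -> b 3 0 = t ->
  let wp := omega R p in let wq := omega R q in
  Qform p q b = x ^+ 2 + t ^+ 2 - 2 * x * t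
    + 2 * (-1 - wp - wq) * (x * y + z * t) + 2 * (-1 + wp - wq) * (x * z + y * t)
    + 2 * (-1 - wp ^+ 2 + wq ^+ 2) * (y * z) + (1 + wp + wq) ^+ 2 * (y ^+ 2 + z ^+ 2).
Proof.
move=> <- <- <- <- wp wq; rewrite /Qform mxE !big_ord_recl big_ord0 !mxE.
rewrite !big_ord_recl !big_ord0 !mxE /=.
have -> : lift ord0 ord0 = 1 :> 'I_4 by apply: val_inj.
have -> : lift ord0 (lift ord0 ord0) = 2 :> 'I_4 by apply: val_inj.
have -> : lift ord0 (lift ord0 (lift ord0 ord0)) = 3 :> 'I_4 by apply: val_inj.
by rewrite -/wp -/wq; ring.
Qed.

Variables (v n1 n2 n3 : 'rV[R]_3).
Hypotheses (n11 : dot n1 n1 = 1) (n22 : dot n2 n2 = 1) (n33 : dot n3 n3 = 1).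
Hypotheses (n13 : dot n1 n3 = 0) (vn2 : dot v n2 = 0) (vn3 : dot v n3 = 0).
Hypotheses (v0 : v != 0) (w1 : dot n2 n3 ^+ 2 != 1).
Hypothesis tangent : dot v n1 ^+ 2 = dot v v - 1.

(** The vector n1 has length 1, and its expansion in v, n2, n3, where v is
    orthogonal to n2 and n3, expresses this length through the three data. The
    hypothesis [tangent] says that the edge from v to its mirror image in n1
    touches the unit sphere. *)
Lemma circumradius : dot v v * dot n1 n2 ^+ 2 = 1 - dot n2 n3 ^+ 2.
Proof.
have vv : dot v v != 0 by rewrite dot_eq0.
have [c2 [c3 E]] := decompose3 n1 v0 n22 n33 w1 vn2 vn3.
move: (congr1 (dot n1) E) (congr1 (dot n2) E) (congr1 (dot n3) E).
rewrite !dot_lin (dotC n1 v) (dotC n2 v) (dotC n3 v) (dotC n3 n1) (dotC n3 n2) (dotC n2 n1).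
rewrite vn2 vn3 n13 n11 n22 n33.
have -> : dot v n1 / dot v v * dot v n1 = 1 - (dot v v)^-1.
  by rewrite mulrAC -expr2 tangent; field.
set s := dot v v; set u := dot n1 n2; set w := dot n2 n3 => E1 E2 E3.
have c3E : c3 = - (c2 * w) by lra.
have uE : u = c2 * (1 - w ^+ 2) by rewrite E2 c3E; ring.
have si : s^-1 = c2 * u by lra.
by rewrite expr2 {2}uE !mulrA -(mulrA s) (mulrC u) -si divff ?mul1r.
Qed.

(** Coordinates are taken in the spanning family (v, n1, n2, n3): the mirrors
    act on them by polynomial formulas in the cosines [dot n1 n2] and
    [dot n2 n3], so the Petrie path of v can be computed symbolically. *)
Let comb (a b c d : R) := a *: v + (b *: n1 + (c *: n2 + d *: n3)).

Let mirror1_comb a b c d : mirror n1 (comb a b c d) =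
  comb a (b - 2 * (a * dot v n1 + b + c * dot n1 n2)) c d.
Proof.
rewrite /mirror /comb !dot_lin n11 (dotC n2 n1) (dotC n3 n1) n13 mulr0 addr0 mulr1.
by rewrite addrA scalerBl -!addrA; congr (_ + (_ + _)); rewrite addrA addrC.
Qed.

Let mirror2_comb a b c d : mirror n2 (comb a b c d) =
  comb a b (c - 2 * (b * dot n1 n2 + c + d * dot n2 n3)) d.
Proof.
rewrite /mirror /comb !dot_lin n22 vn2 (dotC n3 n2) mulr0 add0r mulr1 !addrA.
by rewrite scalerBl !addrA -!(addrA (_ + _ + _)) (addrC (d *: n3)) !addrA.
Qed.

Let mirror3_comb a b c d : mirror n3 (comb a b c d) =
  comb a b c (d - 2 * (c * dot n2 n3 + d)).
Proof.
by rewrite /mirror /comb !dot_lin n33 vn3 n13 !mulr0 !add0r mulr1 scalerBl !addrA.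
Qed.

(** The matrix of the form is, up to a scalar, the inverse of the Gram matrix of
    the Lorentzian vectors (v_i, 1). So the form, evaluated on the values of a
    linear functional at these vectors, is a multiple of the dual Lorentzian norm
    of the functional, here [dot N N - n0 ^+ 2]. Written in the coordinates of N
    this is a polynomial identity modulo [tangent] and [circumradius]. *)
Lemma bend_form_eq0 p q (N : 'rV[R]_3) (n0 kap : R) (b : 'cV[R]_4) :
  4 * dot n1 n2 ^+ 2 = 1 + omega R p -> 4 * dot n2 n3 ^+ 2 = 1 + omega R q ->
  dot N N = n0 ^+ 2 ->
  let v1 := mirror n1 v in let v2 := mirror n1 (mirror n2 v1) in
  let v3 := mirror n1 (mirror n2 (mirror n3 v2)) in
  b 0 0 = kap * (dot v N - n0) -> b 1 0 = kap * (dot v1 N - n0) ->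
  b 2 0 = kap * (dot v2 N - n0) -> b 3 0 = kap * (dot v3 N - n0) ->
  Qform p q b = 0.
Proof.
move=> up wq NN v1 v2 v3 b0 b1 b2 b3.
rewrite (Qform_expand p q b0 b1 b2 b3).
have -> : omega R p = 4 * dot n1 n2 ^+ 2 - 1 by rewrite up addrC addKr.
have -> : omega R q = 4 * dot n2 n3 ^+ 2 - 1 by rewrite wq addrC addKr.
rewrite /v3 /v2 /v1 => {up wq b0 b1 b2 b3 v1 v2 v3 b}.
have -> : v = comb 1 0 0 0 by rewrite /comb scale1r !scale0r !addr0.
rewrite !(mirror1_comb, mirror2_comb, mirror3_comb).
have combN a b c d : dot (comb a b c d) N =
    a * dot v N + (b * dot n1 N + (c * dot n2 N + d * dot n3 N)).
  by rewrite /comb !dot_lin.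
rewrite !combN {combN}.
have [c2 [c3]] := decompose3 N v0 n22 n33 w1 vn2 vn3.
set c1 := _ / _ => NE.
have vN : dot v N = c1 * dot v v by rewrite NE !dot_lin vn2 vn3; ring.
have n1N : dot n1 N = c1 * dot v n1 + c2 * dot n1 n2.
  by rewrite NE !dot_lin n13 (dotC n1 v); ring.
have n2N : dot n2 N = c2 + c3 * dot n2 n3.
  by rewrite NE !dot_lin n22 (dotC n2 v) vn2; ring.
have n3N : dot n3 N = c2 * dot n2 n3 + c3.
  by rewrite NE !dot_lin n33 (dotC n3 v) vn3 (dotC n3 n2); ring.
have {}NN : n0 ^+ 2 = c1 ^+ 2 * dot v v + c2 ^+ 2 + c3 ^+ 2 + 2 * c2 * c3 * dot n2 n3.
  by rewrite -NN {1}NE !dot_lin vN n2N n3N; ring.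
have w2 : dot n2 n3 ^+ 2 = 1 - dot v v * dot n1 n2 ^+ 2.
  by rewrite circumradius subKr.
rewrite vN n1N n2N n3N; move: c1 tangent w2 NN {NE vN n1N n2N n3N}.
move: (dot v v) (dot v n1) (dot n1 n2) (dot n2 n3) => s h u w c1 hh w2 nn.
ring: hh w2 nn.
Qed.

End FormIdentity.

(** * Oriented circles as Lorentzian vectors *)

Section CircleCoordinates.
Variable R : realType.
Notation plane := 'rV[R]_2.

Record circ := Circ { quad : R; lin : plane; cst : R }.

(** The value at infinity is the leading coefficient, so that the oriented circle
    of T is the set where [ev T] is nonpositive, infinity included. *)
Definition ev (T : circ) (z : hatR2 R) : R :=
  if z is Some x then quad T * dot x x + dot x (lin T) + cst T else quad T.

Definition region T : set (hatR2 R) := [set z | ev T z <= 0]%classic.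

(** The Lorentzian norm of T, invariant under Moebius transformations. *)
Definition disc T : R := dot (lin T) (lin T) - 4 * quad T * cst T.

(** * The bend is determined by the region *)

(** Right continuity at 0 of a quadratic polynomial, in the form in which it gives
    the sign at the end points of a diameter. *)
Lemma limit_ge0 (m k l rho : R) : 0 < rho ->
  (forall d, 0 < d < rho -> 0 <= m + d * (k + l * d)) -> 0 <= m.
Proof.
move=> rho0 H; rewrite leNgt; apply/negP => m0.
(* At d = rho * th the correction to m is at most th * K, which is below - m. *)
pose K := rho * (`|k| + `|l| * rho).
have K0 : 0 <= K by rewrite mulr_ge0 ?(ltW rho0) // addr_ge0 ?mulr_ge0 ?(ltW rho0).
pose D := 1 + K - m.
have D0 : 0 < D by rewrite /D; lra.
pose th := - m / D.
have th0 : 0 < th by rewrite divr_gt0 // oppr_gt0.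
have th1 : th < 1 by rewrite ltr_pdivrMr // /D; lra.
have thK : th * K < - m.
  by rewrite mulrAC ltr_pdivrMr // ltr_pM2l ?oppr_gt0 // /D; lra.
have rth0 : 0 < rho * th by rewrite mulr_gt0.
have rth1 : rho * th < rho by rewrite gtr_pMr.
have := H (rho * th); rewrite rth0 rth1 => /(_ isT).
have : k + l * (rho * th) <= `|k| + `|l| * rho.
  rewrite lerD ?ler_norm // (le_trans (ler_norm _)) // normrM ler_wpM2l //.
  by rewrite ger0_norm ltW.
move=> kl; have := ler_wpM2l (ltW rth0) kl.
have -> : rho * th * (`|k| + `|l| * rho) = th * K by rewrite /K; ring.
lra.
Qed.

(** A polynomial that changes sign at r and - r vanishes there. *)
Lemma quadratic_sign (a b c r : R) : 0 < r ->
  (forall t, `|t| < r -> a * t ^+ 2 + b * t + c <= 0) ->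
  (forall t, r < `|t| -> 0 <= a * t ^+ 2 + b * t + c) ->
  b = 0 /\ c = - (a * r ^+ 2).
Proof.
move=> r0 neg pos.
have endpoint e : `|e| = 1 -> a * r ^+ 2 + b * (e * r) + c = 0.
  move=> e1; have ee : e ^+ 2 = 1 by rewrite -(real_normK (num_real e)) e1 expr1n.
  apply/eqP; rewrite eq_le -oppr_ge0; apply/andP; split.
    apply: (@limit_ge0 _ (2 * a * r + b * e) (- a) r) => // d /andP[d0 dr].
    have := neg (e * (r - d)); rewrite normrM e1 mul1r ger0_norm; last by lra.
    rewrite exprMn ee mul1r ltrBlDr ltrDl => /(_ d0); lra.
  apply: (@limit_ge0 _ (2 * a * r + b * e) a r) => // d /andP[d0 dr].
  have := pos (e * (r + d)); rewrite normrM e1 mul1r ger0_norm; last by lra.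
  rewrite exprMn ee mul1r ltrDl => /(_ d0); lra.
have ep := endpoint 1 (normr1 _); have en := endpoint (-1) (normrN1 _).
have : r * b = r * 0 by lra.
move/(mulfI (lt0r_neq0 r0)) => b0; split=> //.
by move: ep; rewrite b0; lra.
Qed.

Lemma ev_line T (c d : plane) t : dot d d = 1 ->
  ev T (Some (c + t *: d)) =
  quad T * t ^+ 2 + (2 * quad T * dot c d + dot d (lin T)) * t + ev T (Some c).
Proof. by move=> d1; rewrite /ev !dot_lin d1 (dotC d c); ring. Qed.

(** Along every line through c the polynomial of T changes sign exactly at distance
    r, hence it is a multiple of the equation of the circle. The weak form of the
    sign hypotheses lets the lemma serve disks and, after a change of sign,
    exteriors of disks. *)
Lemma round_sign (T : circ) (c : plane) (r : R) : 0 < r ->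
  (forall x, dot (x - c) (x - c) < r ^+ 2 -> ev T (Some x) <= 0) ->
  (forall x, r ^+ 2 < dot (x - c) (x - c) -> 0 <= ev T (Some x)) ->
  0 < disc T -> 0 < quad T /\ Num.sqrt (disc T) = 2 * quad T * r.
Proof.
move=> r0 neg pos D0.
have line d : dot d d = 1 ->
    2 * quad T * dot c d + dot d (lin T) = 0 /\ ev T (Some c) = - (quad T * r ^+ 2).
  move=> d1; apply: quadratic_sign => // t tr; rewrite -(ev_line T c t d1).
    apply: neg; rewrite [c + _]addrC addrK !dot_lin d1 mulr1 -expr2 -real_normK ?num_real //.
    by rewrite ltr_pXn2r ?nnegrE // ltW.
  apply: pos; rewrite [c + _]addrC addrK !dot_lin d1 mulr1 -expr2 -(real_normK (num_real t)).
  by rewrite ltr_pXn2r ?nnegrE // ltW.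
have unit j : dot (delta_mx 0 j : plane) (delta_mx 0 j) = 1.
  rewrite dotE (bigD1 j) //= big1 ?mxE ?eqxx ?mulr1 ?addr0 // => i ij.
  by rewrite mxE eqxx (negPf ij) mul0r.
have delta j (x : plane) : dot (delta_mx 0 j) x = x 0 j.
  rewrite dotE (bigD1 j) //= big1 ?mxE ?eqxx ?mul1r ?addr0 // => i ij.
  by rewrite mxE eqxx (negPf ij) mul0r.
have linE : lin T = - ((2 * quad T) *: c).
  apply/rowP => j; rewrite !mxE; have [+ _] := line _ (unit j).
  by rewrite dotC !delta => H; lra.
have [_] := line _ (unit 0).
rewrite /= linE => evc.
have DE : disc T = (2 * quad T * r) ^+ 2.
  have cE : cst T = quad T * dot c c - quad T * r ^+ 2.
    by move: evc; rewrite !dot_lin; lra.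
  by rewrite /disc cE linE !dot_lin; ring.
have q0 : 0 <= quad T.
  have := neg c; rewrite subrr dot0l /= linE evc exprn_gt0 // => /(_ isT).
  by rewrite oppr_le0 pmulr_lge0 ?exprn_gt0.
have qn0 : quad T != 0.
  by apply: contraTneq D0 => q0'; rewrite DE q0' mulr0 mul0r expr0n ltxx.
split; first by rewrite lt_def qn0.
by rewrite DE sqrtr_sqr ger0_norm // !mulr_ge0 // ltW.
Qed.

(** A circle with negative leading coefficient contains a neighbourhood of infinity, so
    it is not inside a half-plane. *)
Lemma ray_sign T (a : plane) h : quad T < 0 -> a != 0 ->
  exists2 x, h < dot x a & ev T (Some x) <= 0.
Proof.
move=> q0; rewrite -dot_gt0 => aa.
pose M := `|dot a (lin T)| + `|cst T|.
have qa : 0 < - quad T * dot a a by rewrite mulr_gt0 // oppr_gt0.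
pose t := 1 + `|h| / dot a a + M / (- quad T * dot a a).
have M0 : 0 <= M by rewrite addr_ge0.
have h0 : 0 <= `|h| / dot a a by rewrite divr_ge0 // ltW.
have Mq : 0 <= M / (- quad T * dot a a) by rewrite divr_ge0 // ltW.
have t1 : 1 <= t by rewrite /t; lra.
exists (t *: a).
  rewrite dotZl -ltr_pdivrMr //; apply: le_lt_trans (_ : `|h| / dot a a < t).
    by rewrite ler_wpM2r ?ler_norm // invr_ge0 ltW.
  by rewrite /t; lra.
rewrite /= !dot_lin.
have Mt : M <= t * (- quad T * dot a a) by rewrite -ler_pdivrMr // /t; lra.
have := ler_norm (dot a (lin T)); have := ler_norm (cst T).
have := normr_ge0 (cst T); rewrite /M in Mt.
move: (dot a a) (dot a (lin T)) (cst T) (quad T) Mt => A B C q Mt n0 nC nB.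
have tB : t * (`|B| + `|C|) <= t * (t * (- q * A)) by rewrite ler_pM2l //; lra.
have tB1 : t * B <= t * `|B| by rewrite ler_pM2l //; lra.
have tC : `|C| <= t * `|C| by rewrite ler_peMl.
lra.
Qed.

(** The complementary orientation. *)
Definition opp_circ T := Circ (- quad T) (- lin T) (- cst T).

Lemma ev_opp T z : ev (opp_circ T) z = - ev T z.
Proof. by case: z => [x|] //=; rewrite dotNr mulNr !opprD. Qed.

Lemma disc_opp T : disc (opp_circ T) = disc T.
Proof. by rewrite /disc !dot_lin /=; ring. Qed.

Lemma bend_of_region T b : 0 < disc T -> has_bend (region T) b ->
  b * Num.sqrt (disc T) = 2 * quad T.
Proof.
move=> D0; move E : (region T) => C HC.
case: HC E => [c r r0|c r r0|a h a0] E.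
- have inC x : ev T (Some x) <= 0 <-> dot (x - c) (x - c) <= r ^+ 2.
    by suff : region T (Some x) <-> disk c r (Some x) by []; rewrite E.
  have [x x1|x x1|q0 ->] // := @round_sign T c r r0 _ _ D0.
  + by apply/inC/ltW.
  + by rewrite leNgt; apply/negP => /ltW /inC; rewrite leNgt x1.
  + by field; rewrite gt_eqF.
- have inC x : ev T (Some x) <= 0 <-> r ^+ 2 <= dot (x - c) (x - c).
    by suff : region T (Some x) <-> disk_exterior c r (Some x) by []; rewrite E.
  rewrite -disc_opp in D0 *.
  have [x x1|x x1|q0 ->] // := @round_sign (opp_circ T) c r r0 _ _ D0.
  + by rewrite ev_opp oppr_le0 leNgt; apply/negP => /ltW /inC; rewrite leNgt x1.
  + by rewrite ev_opp oppr_ge0; apply/inC/ltW.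
  + by rewrite /=; field; rewrite gt_eqF.
- rewrite mul0r; have : quad T <= 0.
    by suff : region T None by []; rewrite E.
  rewrite le_eqVlt => /orP[/eqP ->|q0]; first by rewrite mulr0.
  have [x hx evx] := ray_sign h q0 a0.
  have : region T (Some x) by [].
  by rewrite E /= leNgt hx.
Qed.

(** * Moebius transformations act on the coordinates *)

(** In coordinates centred at c the inversion exchanges, up to powers of r, the
    leading and the constant coefficient; g and b are the constant and linear
    coefficients of T in these coordinates. *)
Definition inversion_circ (c : plane) (r : R) T :=
  let g := ev T (Some c) in let b := 2 * quad T *: c + lin T in
  Circ (g / r ^+ 2) (b - (2 * g / r ^+ 2) *: c)
       (g / r ^+ 2 * dot c c - dot b c + quad T * r ^+ 2).

Lemma circle_inversionK (c : plane) r : 0 < r ->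
  involutive (circle_inversion c r).
Proof.
move=> r0 [x|] /=; last by rewrite eqxx.
case: eqVneq => [->//|xc] /=.
have d0 : dot (x - c) (x - c) != 0 by rewrite dot_eq0 subr_eq0.
have k0 : r ^+ 2 / dot (x - c) (x - c) != 0.
  by rewrite mulf_neq0 ?invr_eq0 // expf_neq0 // gt_eqF.
rewrite -subr_eq0 addrC addKr scaler_eq0 (negPf k0) subr_eq0 (negPf xc).
congr Some; rewrite dotZl dotZr scalerA; move: (dot _ _) d0 k0 => D d0 k0.
have -> : r ^+ 2 / (r ^+ 2 / D * (r ^+ 2 / D * D)) * (r ^+ 2 / D) = 1.
  by field; rewrite d0 gt_eqF.
by rewrite scale1r addrC subrK.
Qed.

(** Evaluation at a point is transported to evaluation at the inverted point, up to
    a positive factor that depends on the point only. In particular the leading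
    coefficient, which carries the bend, becomes an evaluation again. *)
Lemma inversion_circP (c : plane) r : 0 < r ->
  exists2 lam : hatR2 R -> R, forall z, 0 < lam z & forall T,
    disc (inversion_circ c r T) = disc T /\
    forall z, ev (inversion_circ c r T) z = lam z * ev T (circle_inversion c r z).
Proof.
move=> r0; have rn : r != 0 by rewrite gt_eqF.
have r2 : 0 < r ^+ 2 by rewrite exprn_gt0.
exists (fun z => if z is Some x then
    if x == c then r ^+ 2 else dot (x - c) (x - c) / r ^+ 2 else r ^- 2).
  move=> [x|]; last by rewrite invr_gt0.
  by case: eqVneq => // xc; rewrite divr_gt0 // dot_gt0 subr_eq0.
move=> T; split.
  by rewrite /disc /inversion_circ /= !dot_lin (dotC (lin T) c); field.
move=> [x|] /=; last by rewrite mulrC.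
case: eqVneq => [->|xc] /=.
  by rewrite !dot_lin (dotC (lin T) c); field.
have d0 : dot (x - c) (x - c) != 0 by rewrite dot_eq0 subr_eq0.
set d := x - c in d0 *; have -> : x = c + d by rewrite addrC subrK.
move: d d0 => d d0.
by rewrite !dot_lin !(dotC d c) (dotC (lin T) c) !(dotC d (lin T)); field; rewrite rn d0.
Qed.

Definition reflection_circ (a : plane) (h : R) T :=
  Circ (quad T) (lin T - ((2 * dot a (lin T) + 4 * quad T * h) / dot a a) *: a)
    (cst T + (2 * dot a (lin T) + 4 * quad T * h) * h / dot a a).

Lemma reflK n (a : 'rV[R]_n) h : a != 0 -> involutive (refl a h).
Proof.
rewrite -dot_eq0 => aa x; rewrite /refl !dot_lin -addrA -opprD -scalerDl.
move: (dot x a) => t; have -> : 2 * (t - h) / dot a a +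
    2 * (t - 2 * (t - h) / dot a a * dot a a - h) / dot a a = 0 by field.
by rewrite scale0r subr0.
Qed.

Lemma line_reflectionK (a : plane) h : a != 0 -> involutive (line_reflection a h).
Proof. by move=> a0 [x|] //=; rewrite reflK. Qed.

Lemma reflection_circP (a : plane) h T : a != 0 ->
  disc (reflection_circ a h T) = disc T /\
  forall z, ev (reflection_circ a h T) z = ev T (line_reflection a h z).
Proof.
rewrite -dot_eq0 => aa; split.
  by rewrite /disc /reflection_circ /= !dot_lin (dotC (lin T) a); field.
case=> [x|] //=; rewrite /refl !dot_lin (dotC a x); field; exact: aa.
Qed.

(** The factors of the generators multiply. The factor [lam] is the same for all
    circles: this makes the bends of a whole packing proportional to the values of
    a single evaluation. *)
Lemma moebius_circ mu : is_moebius mu ->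
  exists nu : hatR2 R -> hatR2 R, [/\ cancel mu nu, cancel nu mu &
    exists2 lam : hatR2 R -> R, forall z, 0 < lam z & forall T,
      exists2 T', disc T' = disc T & forall z, ev T' z = lam z * ev T (nu z)].
Proof.
elim=> {mu} [|c r mu r0 _ [nu [munu numu [lam lam0 H]]]|a h mu a0 _ [nu [munu numu [lam lam0 H]]]].
- exists idfun; split=> //; exists (fun=> 1) => // T; exists T => // z.
  by rewrite mul1r.
- have iK := circle_inversionK c r0.
  exists (nu \o circle_inversion c r); split; [|exact: can_comp|].
    by move=> z /=; rewrite iK munu.
  have [l l0 Hl] := inversion_circP c r0.
  exists (fun z => l z * lam (circle_inversion c r z)) => [z|T].
    by rewrite mulr_gt0.
  have [T' DT' evT'] := H T; have [DT'' evT''] := Hl T'.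
  exists (inversion_circ c r T'); first by rewrite DT''.
  by move=> z; rewrite evT'' evT' mulrA.
- have iK := line_reflectionK h a0.
  exists (nu \o line_reflection a h); split; [|exact: can_comp|].
    by move=> z /=; rewrite iK munu.
  exists (lam \o line_reflection a h) => [z|T]; first exact: lam0.
  have [T' DT' evT'] := H T; have [DT'' evT''] := reflection_circP h T' a0.
  exists (reflection_circ a h T'); first by rewrite DT''.
  by move=> z; rewrite evT'' evT'.
Qed.

(** * Stereographic projection *)

Definition shadow (v : 'rV[R]_3) : plane := col' ord_max v.

Definition lift3 (y : plane) (t : R) : 'rV[R]_3 := \row_j oapp (y 0) t (unlift ord_max j).

Lemma lift3_max y t : lift3 y t 0 ord_max = t.
Proof. by rewrite mxE unlift_none. Qed.

Lemma shadow_lift3 y t : shadow (lift3 y t) = y.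
Proof. by apply/rowP => j; rewrite !mxE liftK. Qed.

Lemma dot3E (v w : 'rV[R]_3) :
  dot v w = dot (shadow v) (shadow w) + v 0 ord_max * w 0 ord_max.
Proof.
rewrite !dotE big_ord_recr /=; congr (_ + _); apply: eq_bigr => j _.
by rewrite !mxE; congr (v 0 _ * w 0 _); apply: val_inj; rewrite /= /bump leqNgt ltn_ord.
Qed.

(** Substituting the inverse stereographic projection of x in 1 <= u . v and clearing
    the denominator 1 + |x|^2 gives this equation. *)
Definition cap_circ (v : 'rV[R]_3) :=
  Circ (1 - v 0 ord_max) (- (2 *: shadow v)) (1 + v 0 ord_max).

Lemma disc_cap_circ v : disc (cap_circ v) = 4 * (dot v v - 1).
Proof. by rewrite /disc /= !dot_lin dot3E; ring. Qed.

Lemma stereographic_circle_region v : stereographic_circle v = region (cap_circ v).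
Proof.
apply/seteqP; split => z.
  move=> [u [u1 uv] <-]; rewrite /stereographic; move: u1 uv; rewrite !dot3E.
  case: eqVneq => [->|u3] u1 uv.
    have u0 : shadow u = 0.
      by apply/eqP; rewrite -dot_eq0; move: u1; rewrite mulr1 => u1; apply/eqP; lra.
    by move: uv; rewrite /region /= u0 dot0l add0r mul1r subr_le0.
  rewrite /region /= -/(shadow u) !dot_lin.
  have u31 : 0 < 1 - u 0 ord_max.
    have := dot_ge0 (shadow u); move: u1; rewrite -expr2 => u1 g.
    rewrite lt_neqAle subr_ge0 eq_sym subr_eq0 eq_sym u3 /=.
    by have := sqr_ge0 (u 0 ord_max - 1); nra.
  rewrite -(pmulr_rle0 _ u31).
  have -> : dot (shadow u) (shadow u) = 1 - u 0 ord_max * u 0 ord_max by rewrite -u1; ring.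
  have : 2 * (1 - (dot (shadow u) (shadow v) + u 0 ord_max * v 0 ord_max)) <= 0 by lra.
  apply: le_trans; rewrite le_eqVlt; apply/orP; left; apply/eqP; field.
  by rewrite gt_eqF.
case: z => [x|]; rewrite /region /=; last first.
  rewrite subr_le0 => v3; exists (lift3 0 1).
    by split; rewrite /= dot3E lift3_max shadow_lift3 dot0l add0r mul1r.
  by rewrite /stereographic lift3_max eqxx.
rewrite !dot_lin => evx; pose D := 1 + dot x x.
have D0 : 0 < D by rewrite ltr_pwDl // dot_ge0.
have Dn : D != 0 by rewrite gt_eqF.
have D1 : 1 - (dot x x - 1) / D = 2 / D by rewrite /D in Dn *; field.
exists (lift3 ((2 / D) *: x) ((dot x x - 1) / D)).
  split; rewrite /= dot3E lift3_max shadow_lift3 !dot_lin.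
    by rewrite /D in Dn *; field.
  rewrite -(ler_pM2l D0) mulr1; apply: le_trans (_ : 2 * dot x (shadow v) + (dot x x - 1) * v 0 ord_max <= _).
    by rewrite /D; lra.
  by rewrite le_eqVlt; apply/orP; left; apply/eqP; field.
rewrite /stereographic lift3_max -/(shadow _) shadow_lift3 D1.
case: eqVneq => [E|_].
  by move: D1; rewrite E subrr => /esym/eqP; rewrite mulf_eq0 invr_eq0 (negPf Dn) pnatr_eq0.
by rewrite scalerA mulVf ?scale1r // mulf_neq0 ?invr_eq0 // pnatr_eq0.
Qed.

(** The functional is null because evaluation at z pairs v with the light-like vector
    over the point of the sphere that projects to z. *)
Lemma cap_circ_null (z : hatR2 R) : exists N n0, dot N N = n0 ^+ 2 /\
  forall v, ev (cap_circ v) z = dot v N - n0.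
Proof.
case: z => [x|].
  exists (lift3 (- (2 *: x)) (1 - dot x x)), (- (1 + dot x x)); split=> [|v].
    by rewrite dot3E lift3_max shadow_lift3 !dot_lin; ring.
  by rewrite dot3E lift3_max shadow_lift3 /= !dot_lin (dotC x (shadow v)); ring.
exists (lift3 0 (-1)), (-1); split=> [|v].
  by rewrite dot3E lift3_max shadow_lift3 !dot_lin; ring.
by rewrite dot3E lift3_max shadow_lift3 /= !dot_lin; ring.
Qed.

(** The bend is the leading coefficient of the normalised image circle, that is the
    evaluation at the preimage of infinity of the circle of v. *)
Lemma packing_bends mu : is_moebius mu -> exists N n0, dot N N = n0 ^+ 2 /\
  forall (v : 'rV[R]_3) b, 1 < dot v v ->
    has_bend (mu @` stereographic_circle v)%classic b ->
    b = (Num.sqrt (4 * (dot v v - 1)))^-1 * (dot v N - n0).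
Proof.
move=> /moebius_circ[nu [munu numu [lam lam0 H]]].
have [N [n0 [NN Nv]]] := cap_circ_null (nu None).
exists ((2 * lam None) *: N), (2 * lam None * n0); split=> [|v b v1].
  by rewrite !dot_lin NN; ring.
have [T' DT' evT'] := H (cap_circ v).
have -> : (mu @` stereographic_circle v)%classic = region T'.
  rewrite stereographic_circle_region; apply/seteqP; split => z.
    by move=> [y + <-]; rewrite /region /= evT' munu pmulr_rle0.
  by rewrite /region /= evT' pmulr_rle0 // => evz; exists (nu z).
have D0 : 0 < 4 * (dot v v - 1) by rewrite mulr_gt0 // subr_gt0.
move=> /bend_of_region; rewrite DT' disc_cap_circ => /(_ D0) E.
have S0 : Num.sqrt (4 * (dot v v - 1)) != 0 by rewrite sqrtr_eq0 -ltNge.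
apply: (mulIf S0); rewrite E -[quad T']/(ev T' None) evT' Nv dotZr.
by move: (Num.sqrt _) S0 => S S0; field.
Qed.

End CircleCoordinates.

(** * Faces, vertices and symmetries of polytopes *)

Local Open Scope classical_set_scope.
Local Open Scope card_scope.

Lemma card_II_seq (T : choiceType) (A : set T) n : A #= `I_n ->
  exists s : seq T, [/\ uniq s, size s = n & forall x, x \in s <-> A x].
Proof.
move=> An; have finA : finite_set A by exists n.
exists (finmap.enum_fset (fset_set A)); split; [exact: finmap.fset_uniq|exact: card_fset_set|].
by move=> x; rewrite in_fset_set // inE.
Qed.

Lemma involutive_image (T : Type) (g : T -> T) (A : set T) : involutive g ->
  (forall x, A x -> A (g x)) -> g @` A = A.
Proof.
move=> gK gA; apply/seteqP; split => [_ [y /gA Ay <-]//|x Ax].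
by exists (g x); [exact: gA | exact: gK].
Qed.

Section Faces.
Variables (R : realType) (n : nat).
Implicit Types (v x a e : 'rV[R]_n) (h : R) (P F : set 'rV[R]_n).

Lemma image_invariant (g : 'rV[R]_n -> 'rV[R]_n) F x : g @` F = F -> F x -> F (g x).
Proof. by move=> gF Fx; rewrite -gF; exists x. Qed.

Lemma vertexP P v : vertices P v <->
  P v /\ exists a h, dot v a = h /\ forall x, P x -> x != v -> dot x a < h.
Proof.
split => [[_ [a [h [Pa E]]]]|[Pv [a [h [va Pa]]]]].
  have [Pv va] : (P `&` [set x | dot x a = h]) v by rewrite -E.
  split=> //; exists a, h; split=> // x Px xv; rewrite lt_neqAle Pa // andbT.
  apply: contra_neqN xv => /eqP xa.
  by have : [set v] x by rewrite E.
split.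
  exists v, (0 : 'M[R]_(0, n)); split=> //; first by rewrite /row_free mxrank0.
    by case.
  by move=> x ->; rewrite subrr sub0mx.
exists a, h; split=> [x Px|].
  by have [->|/(Pa _ Px)/ltW//] := eqVneq x v; rewrite va.
apply/seteqP; split => [x -> //|x [Px /= xa]].
by apply/eqP/negPn/negP => /(Pa _ Px); rewrite xa ltxx.
Qed.

(** At a point exposed by a the average of the values of a over s attains its
    maximum, so some point of s attains it as well. *)
Lemma vertices_of_hull (s : seq 'rV[R]_n) : vertices (convex_hull s) `<=` [set` s].
Proof.
move=> v /vertexP[[c [c0 c1 vE]] [a [h [va Pa]]]].
have Ps (i : 'I_(size s)) : convex_hull s s`_i.
  exists (fun j => (j == i)%:R); split=> [j||]; first exact: ler0n.
    by rewrite (bigD1 i) //= eqxx big1 ?addr0 // => j /negPf ->.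
  by rewrite (bigD1 i) //= eqxx scale1r big1 ?addr0 // => j /negPf ->; rewrite scale0r.
have le (i : 'I_(size s)) : dot s`_i a <= h.
  by have [->|/(Pa _ (Ps i))/ltW//] := eqVneq s`_i v; rewrite va.
have term0 : \sum_i c i * (h - dot s`_i a) = 0.
  under eq_bigr do rewrite mulrBr.
  rewrite sumrB -mulr_suml c1 mul1r -va vE dot_suml -sumrB big1 // => i _.
  by rewrite dotZl subrr.
have [i ci] : exists i, c i != 0.
  apply: contrapT => /forallNP c00; move/eqP: c1; rewrite big1 ?(eq_sym 0) ?oner_eq0 //.
  by move=> i _; apply/eqP/negPn/negP/c00.
have /eqP : c i * (h - dot s`_i a) = 0.
  move/eqP: term0; rewrite psumr_eq0 => [/allP/(_ i (mem_index_enum _))/eqP //|j _].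
  by rewrite mulr_ge0 // subr_ge0.
rewrite mulf_eq0 (negPf ci) subr_eq0 => /eqP sih.
have [siv|siv] := eqVneq s`_i v; first by rewrite /= -siv mem_nth.
by have := Pa _ (Ps i) siv; rewrite -sih ltxx.
Qed.

Lemma polytope_vertices_finite P : is_polytope P -> finite_set (vertices P).
Proof.
by move=> [s ->]; apply: sub_finite_set (@vertices_of_hull s) (finite_seq s).
Qed.

Lemma refl_vertices a h P v : a != 0 -> (forall x, P x -> P (refl a h x)) ->
  vertices P v -> vertices P (refl a h v).
Proof.
move=> a0 rP /vertexP[Pv [c [k [vc Pc]]]]; have rK := reflK h a0.
pose c' := c - (2 * dot a c / dot a a) *: a.
pose d := 2 * h * dot a c / dot a a.
have rc x : dot (refl a h x) c' = dot x c - d.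
  by rewrite /refl /c' /d !dot_lin; field; rewrite dot_eq0.
apply/vertexP; split; first exact: rP.
exists c', (k - d); split=> [|x Px xv]; first by rewrite rc vc.
rewrite -(rK x) rc ltrD2r; apply: Pc; first exact: rP.
by apply: contraNneq xv => <-; rewrite rK.
Qed.

(** A reflection that preserves a polytope with centroid 0 permutes its
    vertices, hence fixes 0: it is a mirror with a unit normal. *)
Lemma symmetric_refl_linear P r : is_polytope P -> vertices P !=set0 ->
  \sum_(v \in vertices P) v = 0 -> is_reflection r ->
  (forall x, P x -> P (r x)) -> exists2 e, dot e e = 1 & r = mirror e.
Proof.
move=> Ppoly [v0 Pv0] sum0 [a [h [a0 rE]]] rP; subst r.
have finV := polytope_vertices_finite Ppoly.
rewrite (fsbig_finite _ _ finV) in sum0.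
set t := finmap.enum_fset _ in sum0.
have tV x : x \in t <-> vertices P x by rewrite in_fset_set // inE.
have rK := reflK h a0; have aa : dot a a != 0 by rewrite dot_eq0.
have rt : perm_eq (map (refl a h) t) t.
  apply: uniq_perm; rewrite ?map_inj_uniq ?finmap.fset_uniq //; first exact: inv_inj rK.
  move=> x; apply/mapP/idP => [[y /tV Vy ->]|/tV Vx].
    by apply/tV/refl_vertices.
  by exists (refl a h x); [apply/tV/refl_vertices | rewrite rK].
have : dot (\sum_(x <- t) refl a h x) a = 0.
  by rewrite -(big_map _ predT id) (perm_big _ rt) sum0 dot0l.
have -> : dot (\sum_(x <- t) refl a h x) a = 2 * h * (size t)%:R - dot (\sum_(x <- t) x) a.
  rewrite !dot_suml -sum1_size natr_sum mulr_sumr -sumrB; apply: eq_bigr => x _.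
  by rewrite /refl !dot_lin divfK // mulr1; ring.
rewrite sum0 dot0l subr0 => /eqP; rewrite mulf_eq0 mulf_eq0 pnatr_eq0 /= pnatr_eq0.
have /negPf -> : size t != 0%N by rewrite size_eq0; apply/eqP => t0; have /tV := Pv0; rewrite t0.
rewrite orbF => /eqP h0.
have sa0 : 0 < Num.sqrt (dot a a) by rewrite sqrtr_gt0 dot_gt0.
have sa2 : Num.sqrt (dot a a) ^+ 2 = dot a a by rewrite sqr_sqrtr // dot_ge0.
exists ((Num.sqrt (dot a a))^-1 *: a).
  rewrite !dot_lin; move: (Num.sqrt _) sa0 sa2 => q q0 <-.
  by field; rewrite gt_eqF.
apply/funext => x; rewrite /refl /mirror h0 subr0 dotZr scalerA.
move: (Num.sqrt _) sa0 sa2 => q q0 <-.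
by congr (x - _ *: a); field; rewrite gt_eqF.
Qed.

Lemma mirror_vertices P e v : dot e e = 1 -> (forall x, P x -> P (mirror e x)) ->
  vertices P v -> vertices P (mirror e v).
Proof.
move=> e1; have e0 : e != 0 by rewrite -dot_eq0 e1 oner_eq0.
have -> : mirror e = refl e 0 by apply/funext => x; rewrite /mirror /refl e1 subr0 divr1.
by move=> rP; apply: refl_vertices.
Qed.

Lemma mirror_has_dim k e F : dot e e = 1 -> has_dim k F -> has_dim k (mirror e @` F).
Proof.
move=> e1 [x0 [B [freeB Fx0 FB subB]]].
pose M : 'M[R]_n := 1%:M - 2 *: (e^T *m e).
have eM x : x *m M = mirror e x.
  rewrite /M mulmxBr mulmx1 -scalemxAr mulmxA /mirror; congr (x - _).
  rewrite [x *m e^T]mx11_scalar mul_scalar_mx scalerA.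
  by rewrite /dot.
have MM : M *m M = 1%:M.
  by apply/row_matrixP => i; rewrite row_mul rowE !eM mirrorK // row1.
exists (mirror e x0), (B *m M); split.
- by rewrite /row_free mxrankMfree // row_free_unit; case/mulmx1_unit: MM.
- by exists x0.
- by move=> i; exists (x0 + row i B) => //; rewrite row_mul !eM mirrorD.
- by move=> _ [x Fx <-]; rewrite -mirrorB -eM submxMr // subB.
Qed.

Lemma has_dim_uniq j k F : has_dim j F -> has_dim k F -> (j <= k)%N.
Proof.
move=> [x [B [freeB Fx FB _]]] [y [C [_ _ _ subC]]].
rewrite -(eqP freeB); apply: leq_trans (_ : \rank C <= k)%N; last exact: rank_leq_row.
apply: mxrankS; apply/row_subP => i.
have -> : row i B = (x + row i B - y) - (x - y) by rewrite opprB addrA subrK addrC addKr.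
by rewrite addmx_sub ?eqmx_opp ?subC.
Qed.

Lemma has_dim1_line F x y z : has_dim 1 F -> F x -> F y -> F z -> y != x ->
  exists l, z - x = l *: (y - x).
Proof.
move=> [x0 [B [_ _ _ sub]]] Fx Fy Fz yx.
have diff w : F w -> exists l, w - x = l *: B.
  move=> Fw; have -> : w - x = (w - x0) - (x - x0) by rewrite opprB addrA subrK.
  by apply/sub_rVP; rewrite addmx_sub ?eqmx_opp ?sub.
have [[k yE] [l zE]] := (diff y Fy, diff z Fz).
have k0 : k != 0.
  by apply: contraNneq yx => k0; rewrite -subr_eq0 yE k0 scale0r.
by exists (l / k); rewrite yE zE scalerA divfK.
Qed.

End Faces.

(** * Regular flags and their mirrors *)

(** A flag v, E, F of a polyhedron centred at 0 together with unit normals of the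
    mirrors of its fundamental symmetries. *)
Record mirror_flag (R : realType) (P E F : set 'rV[R]_3) (v e1 e2 e3 : 'rV[R]_3)
    : Prop := MirrorFlag {
  flag_polytope : is_polytope P;
  flag_dim : has_dim 3 P;
  flag_centroid : \sum_(x \in vertices P) x = 0;
  flag_unit : [/\ dot e1 e1 = 1, dot e2 e2 = 1 & dot e3 e3 = 1];
  flag_sym : forall x, P x -> [/\ P (mirror e1 x), P (mirror e2 x) & P (mirror e3 x)];
  flag_vertex : vertices P v;
  flag_edge : is_face 1 P E;
  flag_face : is_face 2 P F;
  flag_incident : E v /\ E `<=` F;
  flag_vertex_mirror : [/\ mirror e1 v <> v, mirror e2 v = v & mirror e3 v = v];
  flag_edge_mirror :
    [/\ mirror e1 @` E = E, mirror e2 @` E <> E & mirror e3 @` E = E];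
  flag_face_mirror :
    [/\ mirror e1 @` F = F, mirror e2 @` F = F & mirror e3 @` F <> F] }.

Section Flag.
Variables (R : realType) (P E F : set 'rV[R]_3) (v e1 e2 e3 : 'rV[R]_3).
Hypothesis flag : mirror_flag P E F v e1 e2 e3.

Let Ppoly := flag_polytope flag.
Let Pdim := flag_dim flag.
Let sum0 := flag_centroid flag.
Let e11 : dot e1 e1 = 1. Proof. by case: (flag_unit flag). Qed.
Let e22 : dot e2 e2 = 1. Proof. by case: (flag_unit flag). Qed.
Let e33 : dot e3 e3 = 1. Proof. by case: (flag_unit flag). Qed.
Let P1 x : P x -> P (mirror e1 x). Proof. by case/(flag_sym flag). Qed.
Let P2 x : P x -> P (mirror e2 x). Proof. by case/(flag_sym flag). Qed.
Let P3 x : P x -> P (mirror e3 x). Proof. by case/(flag_sym flag). Qed.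
Let Vv := flag_vertex flag.
Let faceE := flag_edge flag.
Let faceF := flag_face flag.
Let Ev : E v. Proof. by case: (flag_incident flag). Qed.
Let EF : E `<=` F. Proof. by case: (flag_incident flag). Qed.
Let v1 : mirror e1 v <> v. Proof. by case: (flag_vertex_mirror flag). Qed.
Let v2 : mirror e2 v = v. Proof. by case: (flag_vertex_mirror flag). Qed.
Let v3 : mirror e3 v = v. Proof. by case: (flag_vertex_mirror flag). Qed.
Let E1 : mirror e1 @` E = E. Proof. by case: (flag_edge_mirror flag). Qed.
Let E2 : mirror e2 @` E <> E. Proof. by case: (flag_edge_mirror flag). Qed.
Let E3 : mirror e3 @` E = E. Proof. by case: (flag_edge_mirror flag). Qed.
Let F1 : mirror e1 @` F = F. Proof. by case: (flag_face_mirror flag). Qed.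
Let F2 : mirror e2 @` F = F. Proof. by case: (flag_face_mirror flag). Qed.
Let F3 : mirror e3 @` F <> F. Proof. by case: (flag_face_mirror flag). Qed.

Let k := 2 * dot v e1.
Let u := dot e1 e2.
Let w := dot e2 e3.
Let vv := mirror e1 v.

Let vvE : vv = v - k *: e1. Proof. by []. Qed.

Lemma v_perp2 : dot v e2 = 0. Proof. exact: mirror_fixed. Qed.

Lemma v_perp3 : dot v e3 = 0. Proof. exact: mirror_fixed. Qed.

Lemma v_e1_neq0 : dot v e1 != 0.
Proof. by apply/eqP => /mirror_id. Qed.

Let k0 : k != 0. Proof. by rewrite mulf_neq0 ?pnatr_eq0 // v_e1_neq0. Qed.

Lemma v_neq0 : v != 0.
Proof. by apply: contraNneq v_e1_neq0 => ->; rewrite dot0l. Qed.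

Let Evv : E vv. Proof. exact: image_invariant. Qed.

Let Fv : F v. Proof. exact: EF. Qed.
Let Fvv : F vv. Proof. exact: EF. Qed.

Let vv_v : vv != v. Proof. exact/eqP. Qed.

Let edge_line x : E x -> exists l, x - v = l *: e1.
Proof.
move=> Ex; have [l ->] := has_dim1_line faceE.1 Ev Evv Ex vv_v.
by exists (- (l * k)); rewrite vvE addrC addKr scalerN scalerA scaleNr.
Qed.

(** The mirror of e3 preserves the line of E, so e1 is an eigenvector of it; the
    eigenvalue -1 would make the mirrors of e1 and e3 equal. *)
Lemma e1_perp3 : dot e1 e3 = 0.
Proof.
have Ex : E (mirror e3 vv) by exact: image_invariant.
have [l] := edge_line Ex.
rewrite -[X in _ - X]v3 -mirrorB vvE addrC addKr -scaleNr mirrorZ => H.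
have e3e1 : mirror e3 e1 = (- l / k) *: e1.
  apply: (@scalerI _ _ (- k)); first by rewrite oppr_eq0.
  by rewrite H scalerA; congr (_ *: _); field; exact: k0.
apply: (mirror_fixed e33); rewrite e3e1.
move: e3e1; set m := - l / k => e3e1.
have : m ^+ 2 = 1.
  by have := mirror_isom e33 e1 e1; rewrite e3e1 !dot_lin e11 mulr1 -expr2.
move/eqP; rewrite sqrf_eq1 => /orP[/eqP ->|/eqP m1]; first by rewrite scale1r.
exfalso; apply: v1; rewrite -[RHS]v3; apply: (mirror_parallel _ e11 e33).
move: e3e1; rewrite m1 scaleN1r /mirror => /eqP; rewrite subr_eq addrC -subr_eq opprK.
rewrite -mulr2n -scaler_nat mulrC => /eqP H2.
apply: (@scalerI _ _ 2); first by rewrite pnatr_eq0.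
by rewrite H2 scalerA mulrC.
Qed.

(** Otherwise the mirror of e2 would fix the line of E. *)
Lemma cos12_neq0 : dot e1 e2 != 0.
Proof.
apply/eqP => u0; apply: E2; apply: involutive_image; first exact: mirrorK.
move=> x Ex; have [l xv] := edge_line Ex.
have -> : x = l *: e1 + v by rewrite -xv subrK.
by rewrite mirrorD mirrorZ v2 mirror_id // -xv subrK.
Qed.

Lemma cos12_neq1 : dot e1 e2 ^+ 2 != 1.
Proof.
apply/eqP => /(unit_parallel e11 e22) H; apply: v1.
by rewrite (mirror_parallel _ e11 e22 H).
Qed.

Lemma cos23_neq1 : dot e2 e3 ^+ 2 != 1.
Proof.
apply/eqP => /(unit_parallel e22 e33) H; apply: E2.
by rewrite -[RHS]E3; apply: eq_imagel => x _; apply: mirror_parallel H.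
Qed.

Let v2v : mirror e2 vv - v = - k *: (e1 - (2 * u) *: e2).
Proof.
rewrite -[X in _ - X]v2 -mirrorB vvE addrC addKr -scaleNr mirrorZ.
by rewrite /mirror -/u.
Qed.

(** The vertices v, [vv] and its image under the mirror of e2 lie in F and are not
    collinear: a vector of constant height on them is orthogonal to F. *)
Let perp12 x : dot vv x = dot v x -> dot (mirror e2 vv) x = dot v x ->
  dot e1 x = 0 /\ dot e2 x = 0.
Proof.
move=> A B.
have e1x : dot e1 x = 0.
  apply: (mulfI k0); rewrite mulr0.
  by move: A; rewrite vvE !dot_lin => A; lra.
split=> //; have : dot (mirror e2 vv - v) x = 0 by rewrite dotDl dotNl B subrr.
rewrite v2v !dot_lin e1x => /eqP; rewrite mulf_eq0 oppr_eq0 (negPf k0) /=.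
by rewrite add0r oppr_eq0 !mulf_eq0 pnatr_eq0 (negPf cos12_neq0) /= => /eqP.
Qed.

Lemma face_normal_neq0 G a h : is_face 2 P G -> G = P `&` [set x | dot x a = h] ->
  a != 0.
Proof.
move=> [Gdim _] GE; apply/eqP => a0.
have [x [_ [_ Gx _ _]]] := Gdim.
have h0 : h = 0 by have := Gx; rewrite {1}GE a0 => -[_ /=]; rewrite dot0r.
have GP : G = P.
  by rewrite GE a0 h0; apply/seteqP; split => y; [case | split; rewrite //= dot0r].
by have := has_dim_uniq Pdim; rewrite -GP => /(_ _ Gdim).
Qed.

Let F_normal : exists a h, [/\ a != 0, F = P `&` [set x | dot x a = h],
  forall x, P x -> dot x a <= h & dot e1 a = 0 /\ dot e2 a = 0].
Proof.
have [_ [a [h [Pa FE]]]] := faceF; have a0 := face_normal_neq0 faceF FE.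
exists a, h; split=> //.
have val x : F x -> dot x a = h by rewrite {1}FE => -[].
by apply: perp12; rewrite !val //; apply: image_invariant.
Qed.

Let F_plane x : F x -> exists c1 c2, x = v + (c1 *: e1 + c2 *: e2).
Proof.
have [a [h [a0 FE _ [a1 a2]]]] := F_normal => Fx.
have val y : F y -> dot y a = h by rewrite {1}FE => -[].
rewrite dotC in a1; rewrite dotC in a2.
have xv : dot (x - v) a = 0 by rewrite dotDl dotNl !val // subrr.
have [c1 [c2 E']] := perp_span a0 e11 e22 cos12_neq1 a1 a2 xv.
by exists c1, c2; rewrite -E' addrC subrK.
Qed.

(** Otherwise e3 would be orthogonal to F, and F would lie in the mirror of e3. *)
Lemma cos23_neq0 : dot e2 e3 != 0.
Proof.
apply/eqP => w0; apply: F3; apply: involutive_image; first exact: mirrorK.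
move=> x Fx; have [c1 [c2 xE]] := F_plane Fx.
rewrite mirror_id // xE !dot_lin v_perp3 e1_perp3 w0; ring.
Qed.

(** The polygon is F itself, with the edge E maximised by a supporting functional. *)
Lemma vertex_angle_face p : p \in [:: 3; 4; 5]%N ->
  (vertices P `&` F) #= `I_p -> 4 * dot e1 e2 ^+ 2 = 1 + omega R p.
Proof.
move=> p345 /card_II_seq[s [us sz sV]].
have [_ [c [h [Pc EE]]]] := faceE.
have valE x : E x -> dot x c = h by rewrite {1}EE => -[].
have inP x : x \in s -> P x by move=> /sV[/vertexP[]].
have ec : dot e1 c = 0.
  apply: (mulfI k0); rewrite mulr0; have := valE _ Evv.
  by rewrite -(valE _ Ev) vvE !dot_lin => H; lra.
apply: (@polygon_angle _ _ s e1 e2 v c) => //.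
- exact/sV.
- move=> x /sV[Vx Fx]; apply/sV; split; first exact: mirror_vertices.
  exact: image_invariant.
- move=> x /sV[Vx Fx]; apply/sV; split; first exact: mirror_vertices.
  exact: image_invariant.
- exact: v_perp2.
- exact: v_e1_neq0.
- exact: cos12_neq0.
- exact: cos12_neq1.
- by move=> x /sV[_ /F_plane].
- move=> y /sV[/vertexP[_ [a [m [ya Pa]]]] _]; exists a => x /inP Px xy.
  by rewrite ya; apply: Pa.
- apply/eqP => e2c; have FE : F = E.
    apply/seteqP; split => // x Fx; rewrite EE; split.
      by case: faceF => _ [a [m [_ FE]]]; move: Fx; rewrite FE => -[].
    have [c1 [c2 ->]] := F_plane Fx.
    by rewrite /= !dot_lin ec e2c (valE _ Ev); ring.
  by apply: E2; rewrite -FE.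
- by move=> x /inP Px; rewrite (valE _ Ev) Pc.
Qed.

(** * The polar polygon of the faces at a vertex *)

(** The centroid gives 0 <= h. If h were 0, all vertices would have height 0, and
    those obtained from v by the mirrors already span the space. *)
Lemma face_height_gt0 G a h : is_face 2 P G -> G v ->
  (forall x, P x -> dot x a <= h) -> G = P `&` [set x | dot x a = h] -> 0 < h.
Proof.
move=> faceG Gv Pa GE; have a0 := face_normal_neq0 faceG GE.
have finV := polytope_vertices_finite Ppoly.
have va : dot v a = h by move: Gv; rewrite GE => -[].
move: sum0; rewrite (fsbig_finite _ _ finV).
set t := finmap.enum_fset _ => sumt.
have tV x : x \in t <-> vertices P x by rewrite in_fset_set // inE.
have Vh x : vertices P x -> dot x a <= h by move=> /vertexP[Px _]; exact: Pa.
rewrite ltNge; apply/negP => h0.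
have Va x : vertices P x -> dot x a = 0.
  move=> Vx; have : \sum_(x <- t) - dot x a = 0.
    by rewrite sumrN -dot_suml sumt dot0l oppr0.
  rewrite big_seq => /eqP; rewrite psumr_eq0 => [/allP H|y /tV/Vh yh]; last first.
    by rewrite oppr_ge0; lra.
  by have := Vx; rewrite -tV => xt; have := H _ xt; rewrite xt oppr_eq0 => /eqP.
have Vvv : vertices P vv by exact: mirror_vertices.
have V2 : vertices P (mirror e2 vv) by exact: mirror_vertices.
have [a1 a2] : dot e1 a = 0 /\ dot e2 a = 0 by apply: perp12; rewrite !Va.
have a3 : dot e3 a = 0.
  have := Va _ (mirror_vertices e33 P3 V2); rewrite dot_mirrorE (Va _ V2) sub0r.
  have -> : mirror e2 vv = v + - k *: (e1 - (2 * u) *: e2) by rewrite -v2v addrC subrK.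
  rewrite !dot_lin v_perp3 e1_perp3 -/w => /eqP.
  rewrite oppr_eq0 mulf_eq0 => /orP[|/eqP //].
  rewrite mulf_eq0 pnatr_eq0 /= !add0r mulf_eq0 oppr_eq0 (negPf k0) oppr_eq0 /=.
  by rewrite !mulf_eq0 pnatr_eq0 (negPf cos12_neq0) (negPf cos23_neq0).
case/eqP: a0; apply: (perp3_eq0 v_neq0 e22 e33 cos23_neq1 v_perp2 v_perp3).
- by rewrite dotC Va.
- by rewrite dotC.
- by rewrite dotC.
Qed.

(** The normals of the faces at v, scaled to height 1. They are the vertices of the
    face of the polar polyhedron that corresponds to v. *)
Let polar : set 'rV[R]_3 := [set a | [/\ dot v a = 1,
  forall x, P x -> dot x a <= 1 & has_dim 2 (P `&` [set x | dot x a = 1])]].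

Let polar_face (a : 'rV[R]_3) := P `&` [set x | dot x a = 1].

Let polar_of_face G : is_face 2 P G -> G v -> exists2 a, polar a & G = polar_face a.
Proof.
move=> faceG Gv; have [Gdim [a [h [Pa GE]]]] := faceG.
have h0 := face_height_gt0 faceG Gv Pa GE.
have hE x : (dot x (h^-1 *: a) = 1) <-> (dot x a = h).
  rewrite dotZr; split => [H|->]; last by rewrite mulVf // gt_eqF.
  by rewrite -[RHS]mulr1 -H mulVKf // gt_eqF.
have GE' : G = polar_face (h^-1 *: a).
  by rewrite GE /polar_face; congr (_ `&` _); apply/seteqP; split => x /= /hE.
exists (h^-1 *: a) => //; split; last by rewrite -/(polar_face _) -GE'.
- by apply/hE; move: Gv; rewrite GE => -[].
- by move=> x /Pa xa; rewrite dotZr ler_pdivrMl // mulr1.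
Qed.

(** A face normalised by height 1 is determined by three of its points: they
    are affinely independent and their plane misses the origin. *)
Let polar_determined a : polar a -> exists x0 x1 x2,
  [/\ polar_face a x0, polar_face a x1, polar_face a x2 &
  forall a', dot x0 a' = 1 -> dot x1 a' = 1 -> dot x2 a' = 1 -> a' = a].
Proof.
move=> [va Pa [x0 [B [freeB Fx0 FB _]]]].
exists x0, (x0 + row 0 B), (x0 + row 1 B); split=> // [||a' e0 e1' e2'].
- exact: FB.
- exact: FB.
have [_ a0] := Fx0; have [_ a1] := FB 0; have [_ a2] := FB 1.
(* Both a and a' are orthogonal to the two directions of the face, hence
   proportional; their value at x0 is the same. *)
have perp (d : 'rV[R]_3) : dot (row 0 B) d = 0 -> dot (row 1 B) d = 0 ->
    (d <= kermx B^T)%MS.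
  move=> d0 d1; apply/sub_kermxP/rowP => j; rewrite [RHS]mxE.
  have -> : (d *m B^T) 0 j = dot (row j B) d.
    by rewrite dotE mxE; apply: eq_bigr => i _; rewrite !mxE mulrC.
  by case: j => [[|[|]]] //= ij; [rewrite -[RHS]d0 | rewrite -[RHS]d1];
     congr (dot (row _ B) d); apply: val_inj.
have an0 : a != 0 by apply: contraTneq isT => a00; move: va; rewrite a00 dot0r => /eqP; rewrite eq_sym oner_eq0.
have rowa : dot (row 0 B) a = 0 /\ dot (row 1 B) a = 0.
  by move: a0 a1 a2 => /= a0 a1 a2; rewrite dotDl a0 in a1; rewrite dotDl a0 in a2; split; lra.
have rowa' : dot (row 0 B) a' = 0 /\ dot (row 1 B) a' = 0.
  by rewrite dotDl e0 in e1'; rewrite dotDl e0 in e2'; split; lra.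
have aker := perp a rowa.1 rowa.2; have aker' := perp a' rowa'.1 rowa'.2.
have /sub_rVP[l a'E] : (a' <= a)%MS.
  apply: submx_trans aker' _; rewrite -(geq_leqif (mxrank_leqif_sup aker)).
  by rewrite mxrank_ker mxrank_tr (eqP freeB) rank_rV an0.
by move: e0; rewrite a'E dotZr a0 mulr1 => ->; rewrite scale1r.
Qed.


Let polar_face_inj a a' : polar a -> polar a' -> polar_face a = polar_face a' -> a = a'.
Proof.
move=> _ pa' aa'; have [x0 [x1 [x2 [+ + + det]]]] := polar_determined pa'.
by rewrite -aa' => -[_ a0] [_ a1] [_ a2]; apply: det.
Qed.

(** The sum of the three determining points of a face exposes its normal among
    the normals of the faces at v. *)
Let polar_exposed a : polar a ->
  exists c, forall a', polar a' -> a' != a -> dot a' c < dot a c.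
Proof.
move=> /polar_determined[x0 [x1 [x2 [[P0 a0] [P1' a1] [P2' a2] det]]]].
exists (x0 + x1 + x2) => a' [_ Pa' _] aa'.
rewrite !(dotC _ (_ + x2)) !(dotDl _ x2) !(dotDl x0) a0 a1 a2.
have a'0 := Pa' _ P0; have a'1 := Pa' _ P1'; have a'2 := Pa' _ P2'.
rewrite ltNge; apply/negP => H; case/eqP: aa'.
by apply: det; lra.
Qed.

Let mirror_polar e a : dot e e = 1 -> (forall x, P x -> P (mirror e x)) ->
  dot v e = 0 -> polar a -> polar (mirror e a).
Proof.
move=> ee Pe ve [va Pa dima]; split.
- by rewrite -dot_mirror mirror_id.
- by move=> x Px; rewrite -dot_mirror; apply/Pa/Pe.
- have -> : P `&` [set x | dot x (mirror e a) = 1] = mirror e @` polar_face a.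
    apply/seteqP; split => [x [Px /= xa]|_ [x [Px /= xa] <-]].
      exists (mirror e x); last exact: mirrorK.
      by split; [exact: Pe | rewrite /= dot_mirror].
    by split; [exact: Pe | rewrite /= dot_mirror mirrorK].
  exact: mirror_has_dim.
Qed.

(** The polygon is the polar one, with vertex the normal of F: the mirror of e3 takes
    it along the polar edge of E, which [vv] maximises as a functional. *)
Lemma vertex_angle_figure q : q \in [:: 3; 4; 5]%N ->
  [set G | is_face 2 P G /\ G v] #= `I_q -> 4 * dot e2 e3 ^+ 2 = 1 + omega R q.
Proof.
move=> q345 cardq.
have /card_II_seq[s [us sz sV]] : polar #= `I_q.
  rewrite -(card_eql (_ : polar_face @` polar #= polar)); last first.
    by apply: inj_card_eq => a a' /[!inE]; apply: polar_face_inj.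
  rewrite (_ : _ @` _ = [set G | is_face 2 P G /\ G v]) //.
  apply/seteqP; split => [_ [a [va Pa dima] <-]|G [faceG Gv]].
    split; last by split; [case/vertexP: Vv | exact: va].
    by split=> //; exists a, 1.
  by have [a pa ->] := polar_of_face faceG Gv; exists a.
have [a pa FE] := polar_of_face faceF Fv.
have val x : F x -> dot x a = 1 by rewrite FE => -[].
have [a1 a2] : dot e1 a = 0 /\ dot e2 a = 0.
  by apply: perp12; rewrite !val //; apply: image_invariant.
rewrite dotC; apply: (@polygon_angle _ _ s e3 e2 a vv) => //.
- exact/sV.
- by move=> x /sV px; apply/sV/mirror_polar => //; apply: v_perp3.
- by move=> x /sV px; apply/sV/mirror_polar => //; apply: v_perp2.
- by rewrite dotC.
- apply/eqP => a3; apply: F3; apply: involutive_image; first exact: mirrorK.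
  move=> x; rewrite FE => -[Px /= xa]; split; first exact: P3.
  by rewrite /= dot_mirror mirror_id.
- by rewrite dotC; exact: cos23_neq0.
- by rewrite dotC; exact: cos23_neq1.
- move=> x /sV[vx _ _]; have [va _ _] := pa.
  have [||c1 [c2 E']] := perp_span v_neq0 e33 e22 _ v_perp3 v_perp2 (_ : dot (x - a) v = 0).
  + by rewrite dotC; exact: cos23_neq1.
  + by rewrite dotDl dotNl !(dotC _ v) vx va subrr.
  by exists c1, c2; rewrite -E' addrC subrK.
- move=> y /sV/polar_exposed[c H]; exists c => x /sV; exact: H.
- by rewrite vvE !dot_lin (dotC e3 v) v_perp3 (dotC e3 e1) e1_perp3; ring.
- rewrite vvE !dot_lin (dotC e2 v) v_perp2 add0r (dotC e2 e1) oppr_eq0.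
  by rewrite mulf_neq0 // cos12_neq0.
- move=> x /sV[_ Px _]; rewrite dotC (dotC a) (val _ Fvv); apply: Px.
  by case/vertexP: (mirror_vertices e11 P1 Vv).
Qed.

(** The point of tangency is the foot of the perpendicular from 0 to the line of E,
    namely [v - dot v e1 *: e1]. *)
Lemma edge_tangent : tangent_to_sphere E -> dot v e1 ^+ 2 = dot v v - 1.
Proof.
move=> [t [Et tt Ht]]; have [l tE] := edge_line Et.
have tx x : E x -> dot t x = 1.
  by move=> /Ht; rewrite dotDr dotNr tt => /eqP; rewrite subr_eq0 => /eqP.
have te1 : dot t e1 = 0.
  apply: (mulfI k0); rewrite mulr0; have := tx _ Evv.
  by rewrite vvE !dot_lin (tx _ Ev) => H; lra.
have tE' : t = v + l *: e1 by rewrite -tE addrC subrK.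
have lE : l = - dot v e1.
  by move: te1; rewrite tE' !dot_lin e11; lra.
by move: (tx _ Ev); rewrite tE' !dot_lin (dotC e1 v) lE expr2; lra.
Qed.

End Flag.

(** * The bends of a fundamental basis *)

Local Close Scope card_scope.
Local Close Scope classical_set_scope.

Theorem proposition1 (R : realType) (p q : nat)
    (hpq : (p, q) \in [:: (3, 3); (3, 4); (4, 3); (3, 5); (5, 3)]%N)
    (P : set 'rV[R]_3) (hP : is_canonical_realisation p q P)
    (S : 'rV[R]_3 -> set (hatR2 R)) (hS : is_polytopal_packing P S)
    (b : 'cV[R]_4) (hb : is_fundamental_bend_vector P S b) :
  Qform p q b = 0.
Proof.
have [p345 q345] : p \in [:: 3; 4; 5]%N /\ q \in [:: 3; 4; 5]%N.
  by move: hpq; rewrite !inE !xpair_eqE => /or4P[|||/orP[]] /andP[/eqP -> /eqP ->].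
have [[[Ppoly Pdim _] [cardF cardv]] sum0 tangent] := hP.
have [Phi [v [[[face mono] [r1 [r2 [r3 [[S1 S2 S3] [Phi0 v1E v2E v3E]]]]]] bends]]] := hb.
have [mu mob SE] := hS.
have Vv : vertices P (v 0) by rewrite /vertices /= -Phi0; apply: (face 0).
have [R1 [_ P1] fix1] := S1; have [R2 [_ P2] fix2] := S2; have [R3 [_ P3] fix3] := S3.
have V0 : (vertices P !=set0)%classic by exists (v 0).
have stab r : (r @` P)%classic = P -> forall x, P x -> P (r x).
  by move=> rP x; exact: image_invariant rP.
have [e1 e11 r1E] := symmetric_refl_linear Ppoly V0 sum0 R1 (stab _ P1).
have [e2 e22 r2E] := symmetric_refl_linear Ppoly V0 sum0 R2 (stab _ P2).
have [e3 e33 r3E] := symmetric_refl_linear Ppoly V0 sum0 R3 (stab _ P3).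
move/stab: P1 => P1; move/stab: P2 => P2; move/stab: P3 => P3.
move: fix1 fix2 fix3 P1 P2 P3 v1E v2E v3E.
rewrite {}r1E {}r2E {}r3E => fix1 fix2 fix3 P1 P2 P3 v1E v2E v3E {S1 S2 S3 R1 R2 R3}.
have fixv e : (mirror e @` Phi 0 = Phi 0)%classic <-> mirror e (v 0) = v 0.
  rewrite Phi0 image_set1; split => [H|-> //].
  by suff : [set v 0]%classic (mirror e (v 0)) by []; rewrite -H.
have flag : mirror_flag P (Phi 1) (Phi 2) (v 0) e1 e2 e3.
  split=> //.
  - by move=> x Px; split; [exact: P1 | exact: P2 | exact: P3].
  - exact: face 1.
  - exact: face 2.
  - by split; [apply: (mono 0 1); rewrite ?Phi0 | exact: mono].
  - by split; [move/fixv/fix1 | apply/fixv/fix2 | apply/fixv/fix3].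
  - by split; [apply/fix1 | move/fix2 | apply/fix3].
  - by split; [apply/fix1 | apply/fix2 | move/fix3].
have cp := vertex_angle_face flag p345 (cardF _ (face 2)).
have cq := vertex_angle_figure flag q345 (cardv _ Vv).
have tan := edge_tangent flag (tangent _ (face 1)).
have s1 : 1 < dot (v 0) (v 0).
  by rewrite -subr_gt0 -tan lt_def sqr_ge0 sqrf_eq0 (v_e1_neq0 flag).
have [N [n0 [NN bendE]]] := packing_bends mob.
(* The vertices v 0, v 1, v 2, v 3 have the same norm, so the same factor relates
   their bends to the functional. *)
have step i j : v j = mirror e1 (v i) \/ v j = mirror e1 (mirror e2 (v i)) \/
    v j = mirror e1 (mirror e2 (mirror e3 (v i))) ->
    vertices P (v i) /\ dot (v i) (v i) = dot (v 0) (v 0) ->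
    vertices P (v j) /\ dot (v j) (v j) = dot (v 0) (v 0).
  by move=> [->|[->|->]] [Vi <-]; rewrite !mirror_isom //; split=> //;
    do ?apply: mirror_vertices.
have V1 := step 0 1 (or_introl v1E) (conj Vv erefl).
have V2 := step 1 2 (or_intror (or_introl v2E)) V1.
have V3 := step 2 3 (or_intror (or_intror v3E)) V2.
have bE i : vertices P (v i) /\ dot (v i) (v i) = dot (v 0) (v 0) ->
    b i 0 = (Num.sqrt (4 * (dot (v 0) (v 0) - 1)))^-1 * (dot (v i) N - n0).
  by move=> [Vi si]; rewrite -si; apply: bendE; [rewrite si | rewrite -SE].
apply: (bend_form_eq0 e11 e22 e33 (e1_perp3 flag) (v_perp2 flag) (v_perp3 flag)
  (v_neq0 flag) (cos23_neq1 flag) tan cp cq NN (bE 0 _) _ _ _) => //.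
- by rewrite -v1E bE.
- by rewrite -v1E -v2E bE.
- by rewrite -v1E -v2E -v3E bE.
Qed.
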